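(* Let $X$ be a Polish space, let $E$ be a countable Borel equivalence relation on $X$, and let $\mu$ be an $E$-invariant Borel probability measure on $X$. Suppose that there is a free Borel action of a countable non-abelian free group on $X$ whose orbit equivalence relation is a subequivalence relation of $E$ with respect to which $\mu$ is ergodic. Then for every non-abelian group $\Gamma$ freely generated by a countable set $S$ and for every $\gamma\in S$, there is a free Borel action of $\Gamma$ on $X$ whose orbit equivalence relation is a subequivalence relation of $E$, such that $\mu$ is ergodic with respect to the equivalence relation generated by $\gamma$ (that is, the orbit equivalence relation of the restriction of the action to the cyclic subgroup $\langle\gamma\rangle$).
   Context: An equivalence relation is countable if all its classes are countable. The orbit equivalence relation generated by an action of $\Gamma$ on $X$ relates $x$ and $y$ iff $\gamma\cdot x=y$ for some $\gamma\in\Gamma$. An action is free if $\gamma\cdot x=x$ only for $\gamma=\mathrm{id}$. A Borel probability measure $\mu$ on $X$ is ergodic with respect to a countable Borel equivalence relation $F$ if every $F$-invariant Borel set is $\mu$-null or $\mu$-conull. It is $E$-invariant if $\mu(B)=\mu(T(B))$ for every Borel $B\subseteq X$ and every Borel automorphism $T\colon X\to X$ whose graph is contained in $E$. ''Countable'' includes both finite and countably infinite. *)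

(* Defs.v *)
From HB Require Import structures.
From Corelib Require Export RelationClasses.
From mathcomp Require Export all_boot all_order all_algebra.
From mathcomp Require Export all_classical all_reals all_analysis.

Set Implicit Arguments.
Unset Strict Implicit.
Unset Printing Implicit Defensive.

Import Order.TTheory GRing.Theory Num.Theory.

Local Open Scope classical_set_scope.

Section polish.
Local Open Scope ring_scope.
Variables (R : realType) (X : topologicalType).

Definition is_metric (d : X -> X -> R) : Prop :=
  [/\ forall x y, 0 <= d x y,
      forall x y, d x y = 0 <-> x = y,
      forall x y, d x y = d y x &
      forall x y z, d x z <= d x y + d y z].

Definition metric_compatible (d : X -> X -> R) : Prop :=
  forall A : set X, open A <->
    (forall x, A x -> exists2 e : R, 0 < e & [set y | d x y < e] `<=` A).

(* Only used for a metric compatible with the topology of X, so the limit may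
   be taken in that topology. *)
Definition metric_complete (d : X -> X -> R) : Prop :=
  forall u : nat -> X,
    (forall e : R, 0 < e ->
      exists N, forall m n, (N <= m)%N -> (N <= n)%N -> d (u m) (u n) < e) ->
    exists l : X, u @ \oo --> l.

Definition polish : Prop :=
  (exists2 D : set X, countable D & dense D) /\
  (exists d : X -> X -> R,
    [/\ is_metric d, metric_compatible d & metric_complete d]).

End polish.

Notation borel X := (g_sigma_algebraType (@open X)).

Section relations.
Variable X : ptopologicalType.

Definition borel_fun (f : X -> X) : Prop :=
  measurable_fun [set: borel X] (f : borel X -> borel X).

Definition borel_automorphism (T : X -> X) : Prop :=
  exists T' : X -> X,
    [/\ cancel T T', cancel T' T, borel_fun T & borel_fun T'].

(* E is Borel for the product topology on X * X. *)
Definition countable_borel_equivalence (E : X -> X -> Prop) : Prop :=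
  [/\ Equivalence E,
      measurable ([set p | E p.1 p.2] : set (borel (X * X)%type)) &
      forall x, countable [set y | E x y]].

Variables (R : realType) (mu : probability (borel X) R).

Definition invariant_measure (E : X -> X -> Prop) : Prop :=
  forall T : X -> X, borel_automorphism T -> (forall x, E x (T x)) ->
  forall B : set (borel X), measurable B -> mu B = mu (T @` B).

Definition ergodic (F : X -> X -> Prop) : Prop :=
  forall B : set (borel X), measurable B ->
    (forall x y, F x y -> (B x <-> B y)) ->
    (mu B = 0 \/ mu (~` B) = 0)%E.

End relations.

Section free_groups.
Local Open Scope group_scope.
Variable G : groupType.

(* Words in S and its formal inverses: the letter (s, false) stands for s and
   (s, true) for s^-1. *)
Definition letter_val (l : G * bool) : G := if l.2 then l.1^-1 else l.1.

Definition word_val (w : seq (G * bool)) : G := \prod_(l <- w) letter_val l.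

Definition reduced (w : seq (G * bool)) : bool :=
  sorted (fun l m => ~~ ((l.1 == m.1) && (l.2 != m.2))) w.

Definition freely_generated_by (S : set G) : Prop :=
  forall g : G, exists! w : seq (G * bool),
    [/\ forall l, l \in w -> S l.1, reduced w & word_val w = g].

Definition free_group : Prop := exists S : set G, freely_generated_by S.

Definition abelian_group : Prop := forall x y : G, x * y = y * x.

Definition cyclic_subgroup (g : G) : set G :=
  [set h | exists n : nat, h = g ^+ n \/ h = g ^- n].

End free_groups.

Section actions.
Local Open Scope group_scope.
Variables (G : groupType) (X : ptopologicalType) (a : G -> X -> X).

Definition is_action : Prop :=
  (forall x, a 1 x = x) /\ (forall g h x, a (g * h) x = a g (a h x)).

(* All groups that act here are countable and discrete, so that the action map
   G * X -> X is Borel exactly when each of the maps a g is. *)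
Definition borel_action : Prop := is_action /\ forall g, borel_fun (a g).

Definition free_action : Prop := forall g x, a g x = x -> g = 1.

Definition orbit_rel (H : set G) (x y : X) : Prop := exists2 g, H g & a g x = y.

End actions.

(* Main.v *)
Require Import Defs.
From mathcomp Require Import measurable_realfun ring lra zify.

(** The proof produces an automorphism [t] of the space that is ergodic, moves
    every point along the orbits of a subgroup [K] of [Delta], and has no
    periodic points, where [K] leaves room for elements [u 0, u 1, ...] of
    [Delta] that together with [K] generate the free product of [K] and a free
    group on the [u n]. Then [gamma] can act as [t] and the other generators of
    [Gamma] as distinct [u n]. A nonzero power of [t] moves a point as a
    nontrivial element of [K] does, so a nonempty reduced word moves a point as
    a nontrivial element of the free product does, and [Delta] acts freely
    ([reduced_word_free]).

    The subgroup. In a nonabelian free group there is an infinite ping-pong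
    table, and each slot of the table can be filled in so many ways that, given
    any group element [g], one may choose between elements [r], [p * r] and
    [p * g * r] ([pingpong_table]). The distance between a set and its
    translate is a length function on the group, so one of the three moves a
    given set at least a quarter as far as [g] does ([displacement_sandwich]).
    When the even slots are filled with such choices for all pairs of an element
    [g] and a set of a countable dense algebra, a set that is invariant under
    the chosen elements is invariant under [Delta] up to null sets. Thus the
    subgroup [K] that they generate acts ergodically ([ergodic_selection]). The
    odd slots provide the [u n].

    The automorphism. By exhaustion, an ergodic group matches any two sets of
    equal measure by an involution along its orbits ([matching]). Starting with
    [C 0 = X], cut [C n] into halves, match one half [C n.+1] with the other one
    by [phi n], and let [t = ... \o phi 2 \o phi 1 \o phi 0]. This is an
    odometer: on [C n.+1] its [2 ^ n]-th power is [phi n], which makes it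
    aperiodic. For ergodicity the cuts are made at medians. For a set [B] of the
    dense algebra, let [G n] be the sum of [\1_B - mu B] over the [2 ^ n] points
    of the tower above a point of [C n]; matching the points of [C n] where
    [G n] is below its median with those where it is above halves the variance of
    the averages [G n / 2 ^ n] ([variance_selected]). Each [B] gets its turn
    infinitely often, so these averages tend to [0]; hence a [t]-invariant set
    [D] is independent of every [B] ([stages_independent]), and therefore of
    itself. *)

Set Implicit Arguments.
Unset Strict Implicit.
Unset Printing Implicit Defensive.

Import Order.TTheory GRing.Theory Num.Theory.
Local Open Scope classical_set_scope.

(** * Normal forms and a ping-pong table in a free group *)

Section NormalForm.
Local Open Scope group_scope.
Variables (G : groupType) (S : set G).
Hypothesis freeS : freely_generated_by S.

Implicit Types (g h : G) (l m : G * bool) (w : seq (G * bool)).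

Definition flip l : G * bool := (l.1, ~~ l.2).

Definition nf g : seq (G * bool) := projT1 (cid (freeS g)).

Lemma nfP g :
  [/\ forall l, l \in nf g -> S l.1, reduced (nf g) & word_val (nf g) = g].
Proof. by rewrite /nf; case: cid => w []. Qed.

Lemma nf_unique w :
  (forall l, l \in w -> S l.1) -> reduced w -> nf (word_val w) = w.
Proof.
move=> Sw rw; rewrite /nf; case: cid => v /= [_]; exact.
Qed.

Lemma word_val_nil : word_val [::] = 1 :> G.
Proof. exact: big_nil. Qed.

Lemma word_val_cons l w : word_val (l :: w) = letter_val l * word_val w.
Proof. exact: big_cons. Qed.

Lemma flipK l : flip (flip l) = l.
Proof. by case: l => s e; rewrite /flip /= negbK. Qed.

Lemma flip_neq l : (flip l == l) = false.
Proof. by case: l => s []; apply/eqP => -[]. Qed.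

Lemma letter_flip l : letter_val (flip l) = (letter_val l)^-1.
Proof. by case: l => s []; rewrite /letter_val //= invgK. Qed.

Lemma flip_compat l m :
  ((l.1 == m.1) && (l.2 != m.2)) = (m == flip l).
Proof.
by case: l m => [s []] [t []]; rewrite /flip -pair_eqE /= /pair_eq /= ?andbF ?andbT // eq_sym.
Qed.

Definition starts l g : bool := ohead (nf g) == Some l.

Lemma nf1 : nf 1 = [::].
Proof. by rewrite -word_val_nil nf_unique. Qed.

(** Multiplying by a letter from the left cancels the first letter of the
    normal form if the two are inverse to each other and prepends the letter
    otherwise; all computations with normal forms go letter by letter. *)
Lemma nf_letter_keep l g :
  S l.1 -> ~~ starts (flip l) g -> nf (letter_val l * g) = l :: nf g.
Proof.
move=> Sl; rewrite /starts; have [Sg rg {2}<-] := nfP g => ng.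
rewrite -word_val_cons nf_unique //.
  by move=> k; rewrite inE => /orP[/eqP ->//|/Sg].
move: ng rg; case: (nf g) => //= k w; rewrite /reduced /= flip_compat => nk ->.
by rewrite andbT; apply: contraNN nk => /eqP ->.
Qed.

Lemma nf_letter_cancel l g :
  S l.1 -> starts (flip l) g -> nf g = flip l :: nf (letter_val l * g).
Proof.
move=> Sl; rewrite /starts; have [Sg rg {3}<-] := nfP g.
case E : (nf g) Sg rg => [//|k w] Sg rg /= /eqP[ek]; subst k.
rewrite word_val_cons letter_flip mulgA mulgV mul1g nf_unique //.
  by move=> k kw; apply: Sg; rewrite inE kw orbT.
exact: path_sorted rg.
Qed.

Lemma starts_mul l g :
  S l.1 -> ~~ starts (flip l) g -> starts l (letter_val l * g).
Proof. by move=> Sl ng; rewrite /starts nf_letter_keep. Qed.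

Lemma starts1 l : starts l 1 = false.
Proof. by rewrite /starts nf1. Qed.

Lemma starts_inj l m g : starts l g -> starts m g -> l = m.
Proof. by move=> /eqP + /eqP => -> []. Qed.

Lemma nseq_shift l n t : nseq n.+1 l ++ t = nseq n l ++ l :: t.
Proof. by elim: n => //= n ->. Qed.

Lemma nf_letter_mul k l g v n t :
  S k.1 -> nf g = v ++ nseq n.+1 l ++ t ->
  exists v' t', nf (letter_val k * g) = v' ++ nseq n l ++ t' /\
    (size v' <= (size v).+1)%N.
Proof.
move=> Sk eg; case: (boolP (starts (flip k) g)) => st; last first.
  by exists (k :: v), (l :: t); rewrite nf_letter_keep // eg nseq_shift.
have := nf_letter_cancel Sk st; rewrite eg.
case: v {eg} => [|k' v] /= [_ <-].
  by exists [::], t.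
by exists v, (l :: t); rewrite -nseq_shift; split=> //; exact: leqW (leqnSn _).
Qed.

(** Each letter eats at most one letter of a power, so behind a prefix that is
    no longer than the word the rest of the power survives. *)
Lemma nf_word_mul w l g v n t :
  (forall k, k \in w -> S k.1) -> nf g = v ++ nseq (size w + n) l ++ t ->
  exists v' t', nf (word_val w * g) = v' ++ nseq n l ++ t' /\
    (size v' <= size w + size v)%N.
Proof.
elim: w n => [|k w IH] n Sw eg.
  by exists v, t; rewrite word_val_nil mul1g.
have Sk : S k.1 by apply: Sw; rewrite inE eqxx.
have [|| v' [t' [e1 s1]]] := IH n.+1.
- by move=> m mw; apply: Sw; rewrite inE mw orbT.
- by rewrite addnS.
have [v2 [t2 [e2 s2]]] := nf_letter_mul Sk e1.
exists v2, t2; rewrite word_val_cons -mulgA; split=> //.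
exact: leq_trans s2 _.
Qed.

Lemma starts_pow l n g :
  S l.1 -> ~~ starts (flip l) g -> nf (letter_val l ^+ n * g) = nseq n l ++ nf g.
Proof.
move=> Sl ng; elim: n => [|n IH]; first by rewrite expg0 mul1g.
rewrite expgS -mulgA nf_letter_keep //= ?IH //.
rewrite /starts IH; case: n {IH} => //= n.
by apply/eqP => -[]/eqP; rewrite eq_sym flip_neq.
Qed.

Lemma starts_pow_absorb l n g v t :
  S l.1 -> nf g = v ++ l :: t -> (size v < n)%N ->
  starts l (letter_val l ^+ n * g).
Proof.
move=> Sl; elim: n g v t => [//|n IH] g v t eg sv.
rewrite expgSr -mulgA.
case: (boolP (starts (flip l) g)) => st.
  have := nf_letter_cancel Sl st; rewrite eg.
  case: v eg sv => [|k v] eg sv /= [].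
    by move=> /eqP; rewrite eq_sym flip_neq.
  by move=> _ /esym /IH; apply.
have := starts_mul Sl st; case: n IH {sv} => [|n] IH; first by rewrite expg0 mul1g.
rewrite /starts; case E : (nf _) => [//|k w] /= /eqP[ek]; subst k.
by apply: (IH _ [::] w).
Qed.

(** The middle element eats only a part of the power on its right, and what
    remains of that power is within reach of the power on its left. *)
Lemma sandwich l g : S l.1 -> exists N, forall n, (N <= n)%N ->
  forall h, ~~ starts (flip l) h ->
  starts l (letter_val l ^+ n * (g * (letter_val l ^+ n * h))).
Proof.
move=> Sl; have [Sg _ eg] := nfP g; exists (size (nf g)).+1 => n len h nh.
have [|v [t [e sv]]] := @nf_word_mul (nf g) l (letter_val l ^+ n * h) [::]
    (n - size (nf g))%N (nf h) Sg.
  by rewrite starts_pow // subnKC // ltnW.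
rewrite eg in e; rewrite -(subnSK len) /= in e.
by apply: starts_pow_absorb e _ => //; rewrite (leq_ltn_trans sv) // addn0.
Qed.

(** A group that is freely generated by at most one element is abelian. *)
Lemma exists_two_generators :
  ~ abelian_group G -> exists a b, [/\ S a, S b & a != b].
Proof.
move=> nab; apply: contrapT => no; apply: nab.
have eqS s t : S s -> S t -> s = t.
  by move=> Ss St; apply: contrapT => /eqP nst; apply: no; exists s, t.
have letters_commute l m : S l.1 -> S m.1 ->
    commute (letter_val l) (letter_val m).
  case: l m => [s d] [t e] /= Ss St; rewrite (eqS s t Ss St).
  case: d e => [] [] /=; rewrite /letter_val /=.
  - exact: commute_refl.
  - exact/commute_sym/commuteV/commute_refl.
  - exact/commuteV/commute_refl.
  - exact: commute_refl.
have word_commute w x : (forall l, l \in w -> S l.1) ->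
    (forall l, l \in w -> commute x (letter_val l)) -> commute x (word_val w).
  elim: w => [|l w IH] Sw cw; first by rewrite word_val_nil; exact: commute1.
  rewrite word_val_cons; apply: commuteM; first by apply: cw; rewrite inE eqxx.
  by apply: IH => m mw; [apply: Sw|apply: cw]; rewrite inE mw orbT.
move=> x y; have [Sx _ <-] := nfP x; have [Sy _ <-] := nfP y.
apply: (word_commute) => // l ly; apply/commute_sym/(word_commute) => // m mx.
by apply: letters_commute; [exact: Sy|exact: Sx].
Qed.

End NormalForm.

Section PingPong.
Local Open Scope group_scope.
Variable G : groupType.

Definition pingpong (P Q : set G) (k : G) : Prop :=
  (forall x, ~ Q x -> P (k * x)) /\ (forall x, ~ P x -> Q (k^-1 * x)).

(** For generators [a <> b] and [c i = a ^ i * b] put into [P i] the elements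
    whose normal form extends that of [c i], that is, the [c i * y] where [y]
    does not start with [b^-1]. An element [c i * m * (c j)^-1] plays ping-pong
    between [P i] and [P j] as soon as multiplication by [m] and by [m^-1] turns
    elements starting with [b^-1] into elements that do not. For every [g] and
    all large [n], the middle parts [a ^ n], [a ^ n * a ^ n] and
    [a ^ n * g * a ^ n] even turn them into elements starting with [a], and the
    inverses of these parts into elements starting with [a^-1]. *)
Theorem pingpong_table : free_group G -> ~ abelian_group G ->
  exists P : nat -> set G,
  [/\ forall i, ~ P i 1,
      forall i j x, P i x -> P j x -> i = j &
      forall i j d, exists p r, [/\ pingpong (P i) (P j) r,
        pingpong (P i) (P j) (p * r) & pingpong (P i) (P j) (p * d * r)]].
Proof.
move=> [S freeS] nab; have [a [b [Sa Sb nab']]] := exists_two_generators freeS nab.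
have [c cE] : exists c : nat -> G, forall i, c i = a ^+ i * b by eexists.
pose B := (b, true).
pose st := starts freeS.
pose P i := [set x | ~~ st B ((c i)^-1 * x)].
have letA : letter_val (a, false) = a by [].
have letA' : letter_val (a, true) = a^-1 by [].
have letB : letter_val (b, false) = b by [].
have letB' : letter_val B = b^-1 by [].
have stA l g n : st l g -> l.1 != a -> (0 < n)%N -> forall e,
    st (a, e) (letter_val (a, e) ^+ n * g).
  move=> stg la n0 e; rewrite /st /starts starts_pow //.
    by case: n n0.
  apply/negP => /starts_inj - /(_ _ stg) el.
  by rewrite -el /= eqxx in la.
have ba : B.1 != a by rewrite eq_sym.
have stB l g : st l g -> l != (b, false) -> st B (b^-1 * g).
  move=> stg lb; rewrite -letB'; apply: starts_mul => //.
  by apply/negP => /starts_inj - /(_ _ stg) el; rewrite -el /flip /B /= eqxx in lb.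
have good i j m :
    (forall y, st B y -> ~~ st B (m * y)) ->
    (forall y, st B y -> ~~ st B (m^-1 * y)) ->
    pingpong (P i) (P j) (c i * m * (c j)^-1).
  move=> m1 m2; split=> x /negP; rewrite negbK => /[dup] xP.
    by move=> /m1; rewrite /P /= -!mulgA mulKg.
  by move=> /m2; rewrite /P /= !invgM invgK -!mulgA mulKg.
have c_st i : st B ((c i)^-1).
  rewrite cE invgM; case: i => [|i].
    rewrite expg0 invg1; rewrite -letB'; apply: starts_mul => //.
    by rewrite starts1.
  apply: (stB (a, true)); last by apply/eqP => -[].
  rewrite -expVgn -letA' -[X in st _ X]mulg1 /st /starts starts_pow ?starts1 //.
have c_cancel i j y : i != j -> ~~ st B y -> st B ((c i)^-1 * (c j * y)).
  move=> ij ny.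
  have yb : st (b, false) (b * y) by rewrite -letB; apply: starts_mul.
  have [e [n n0 ->]] : exists e, exists2 n, (0 < n)%N & (c i)^-1 * (c j * y) =
      b^-1 * (letter_val (a, e) ^+ n * (b * y)).
    move: ij; rewrite neq_ltn => /orP[ij|ji].
      exists false, (j - i)%N; first by rewrite subn_gt0.
      by rewrite !cE letA -{1}(subnKC (ltnW ij)) expgnDr invgM -!mulgA mulKg.
    exists true, (i - j)%N; first by rewrite subn_gt0.
    rewrite !cE letA' -{1}(subnKC (ltnW ji)) expgnDr !invgM -!mulgA mulKg.
    by rewrite expVgn.
  apply: (stB (a, e)); first by apply: (stA (b, false)); rewrite ?(eq_sym b).
  by apply/eqP => -[ab _]; rewrite ab eqxx in nab'.
exists P; split.
- by move=> i; rewrite /P /= mulg1; apply/negP; rewrite negbK.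
- move=> i j x xi xj; apply/eqP; apply: contraT => ij.
  by move: xi; rewrite /P /= -[x in X in X -> _](mulVKg (c j)) c_cancel.
move=> i j d; have [d' dE] : exists d', d' = (c i)^-1 * d * c i by eexists.
have Sl (e : bool) : S (a, e).1 by [].
(* conjugating [d] by [c i] turns [p * d * r] into [c i * (a ^ N * d' * a ^ N) * (c j)^-1] *)
have [N1 h1] := sandwich freeS d' (Sl false).
have [N2 h2] := sandwich freeS d'^-1 (Sl true).
rewrite letA in h1; rewrite letA' in h2.
pose N := maxn 1 (maxn N1 N2).
have N0 : (0 < N)%N by rewrite /N leq_max.
have starts_a e y : st (a, e) y -> ~~ st B y.
  move=> ya; apply/negP => /starts_inj - /(_ _ ya) [ab _].
  by rewrite ab eqxx in nab'.
have not_a e y : st B y -> ~~ st (a, e) y.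
  move=> yB; apply/negP => /starts_inj - /(_ _ yB) [ab _].
  by rewrite ab eqxx in nab'.
have pow_good n : (0 < n)%N -> pingpong (P i) (P j) (c i * a ^+ n * (c j)^-1).
  move=> n0; apply: good => y yB.
    by apply: (starts_a false); rewrite -letA; apply: (stA B).
  by apply: (starts_a true); rewrite -expVgn -letA'; apply: (stA B).
exists (c i * a ^+ N * (c i)^-1), (c i * a ^+ N * (c j)^-1); split.
- exact: pow_good.
- suff -> : c i * a ^+ N * (c i)^-1 * (c i * a ^+ N * (c j)^-1) =
      c i * a ^+ (N + N) * (c j)^-1 by apply: pow_good; rewrite addn_gt0 N0.
  by rewrite expgnDr !mulgA mulgVK.
- suff -> : c i * a ^+ N * (c i)^-1 * d * (c i * a ^+ N * (c j)^-1) =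
      c i * (a ^+ N * d' * a ^+ N) * (c j)^-1.
    apply: good => y yB.
      apply: (starts_a false); rewrite -!mulgA; apply: h1.
        by rewrite /N !leq_max leqnn orbT.
      exact: not_a.
    apply: (starts_a true); rewrite !invgM -!mulgA -expVgn; apply: h2.
      by rewrite /N !leq_max leqnn !orbT.
    exact: not_a.
  by rewrite dE !mulgA.
Qed.

End PingPong.

(** * Actions of free groups and ping-pong *)

Section PingPongSequence.
Local Open Scope group_scope.
Variables (G : groupType) (P : nat -> set G) (h : nat -> G).
Hypothesis P1 : forall i, ~ P i 1.
Hypothesis Pdisj : forall i j x, P i x -> P j x -> i = j.

(** The element [h n] plays between the places [2 * n] and [2 * n + 1] of the
    table. *)
Definition side (l : nat * bool) : nat := (l.1.*2 + l.2)%N.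

Lemma side_inj : injective side.
Proof.
move=> [n e] [m f]; rewrite /side /= => eq.
have ef : e = f by have := congr1 odd eq; rewrite !oddD !odd_double; case: e f {eq} => [] [].
by move: eq; rewrite ef => /addIn /double_inj ->.
Qed.

Hypothesis hP : forall n, pingpong (P (side (n, false))) (P (side (n, true))) (h n).

Definition power (l : nat * bool) : G := if l.2 then (h l.1)^-1 else h l.1.

Lemma power_flip l : power (l.1, ~~ l.2) = (power l)^-1.
Proof. by case: l => n []; rewrite /power //= invgK. Qed.

Lemma power_pingpong l x : ~ P (side (l.1, ~~ l.2)) x -> P (side l) (power l * x).
Proof. by case: l => n []; have [h1 h2] := hP n; [exact: h2|exact: h1]. Qed.

Inductive generated (I : set nat) : G -> Prop :=
| generated1 : generated I 1
| generatedM l g : I l.1 -> generated I g -> generated I (power l * g).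

Lemma generated_mul I g g' : generated I g -> generated I g' ->
  generated I (g * g').
Proof.
move=> Hg Hg'; elim: Hg => [|l k Il _ IH]; first by rewrite mul1g.
by rewrite -mulgA; exact: generatedM.
Qed.

Lemma generated_inv I g : generated I g -> generated I g^-1.
Proof.
elim=> [|l k Il _ IH]; first by rewrite invg1; exact: generated1.
rewrite invgM; apply: generated_mul => //.
rewrite -power_flip -[power _]mulg1; apply: generatedM => //.
exact: generated1.
Qed.

Lemma generated_power I n : I n -> generated I (h n).
Proof.
by move=> In; rewrite -[h n]mulg1; apply: (@generatedM I (n, false)) => //; exact: generated1.
Qed.

Definition eval (w : seq (nat * bool)) : G := foldr (fun l g => power l * g) 1 w.

Definition nocancel (l m : nat * bool) : bool := m != (l.1, ~~ l.2).

Lemma generated_eval I g : generated I g -> exists w,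
  [/\ forall l, l \in w -> I l.1, sorted nocancel w & eval w = g].
Proof.
elim=> [|l k Il _ [w [Iw rw <-]]]; first by exists [::].
case: w Iw rw => [|m w] Iw rw.
  by exists [:: l]; split=> // m; rewrite inE => /eqP ->.
have [e|ne] := eqVneq m (l.1, ~~ l.2); last first.
  exists (l :: m :: w); split=> //; last by rewrite /= /nocancel ne.
  by move=> m'; rewrite inE => /orP[/eqP ->|/Iw].
exists w; split; last by rewrite /= e power_flip mulVKg.
  by move=> m' mw; apply: Iw; rewrite inE mw orbT.
exact: path_sorted rw.
Qed.

Lemma eval_pingpong I l w x :
  (forall m, m \in l :: w -> I m.1) -> sorted nocancel (l :: w) ->
  (forall m, I m.1 -> ~ P (side m) x) -> P (side l) (eval (l :: w) * x).
Proof.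
elim: w l => [|m w IH] l Iw rw nx; rewrite /= -mulgA; apply: power_pingpong.
  by rewrite mul1g; apply: nx; apply: (Iw l); rewrite inE eqxx.
have Pm : P (side m) (eval (m :: w) * x).
  apply: IH => //; last by exact: path_sorted rw.
  by move=> m' mw; apply: Iw; rewrite inE mw orbT.
move=> Pl; have /side_inj ml := Pdisj Pm Pl.
by move: rw; rewrite /= /nocancel ml eqxx.
Qed.

(** A nontrivial element of the subgroup is a nonempty reduced word, whose
    letters are applied one after the other without leaving the table. *)
Lemma generated_pingpong I g x : generated I g -> g != 1 ->
  (forall m, I m.1 -> ~ P (side m) x) ->
  exists2 l, I l.1 & P (side l) (g * x).
Proof.
move=> /generated_eval[[|l w] [Iw rw <-]] g1 nx; first by rewrite eqxx in g1.
exists l; first by apply: Iw; rewrite inE eqxx.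
exact: eval_pingpong nx.
Qed.

Lemma generated_expn n m : (0 < m)%N -> h n ^+ m != 1.
Proof.
move=> m0; suff Pm : P (side (n, false)) (h n ^+ m).
  by apply/eqP => e; rewrite e in Pm; exact: P1 Pm.
have step x : ~ P (side (n, true)) x -> P (side (n, false)) (h n * x).
  by have [hn _] := hP n; exact: hn.
case: m m0 => // m _; elim: m => [|m IH].
  by rewrite -[h n ^+ 1]mulg1; apply: step; exact: P1.
rewrite expgS; apply: step => P'; have := side_inj (Pdisj IH P'); discriminate.
Qed.

End PingPongSequence.

Definition act_word (L T : Type) (f : L -> T -> T) (w : seq L) (x : T) : T :=
  foldr f x w.

Section LetterAction.
Local Open Scope group_scope.
Variables (G : groupType) (S : set G) (T : ptopologicalType).
Variable f : G * bool -> T -> T.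
Hypothesis freeS : freely_generated_by S.
Hypothesis fK : forall l x, f (flip l) (f l x) = x.

Definition letter_action (g : G) : T -> T := act_word f (nf freeS g).

Lemma letter_action_letter l g x : S l.1 ->
  letter_action (letter_val l * g) x = f l (letter_action g x).
Proof.
move=> Sl; rewrite /letter_action; have [st|st] := boolP (starts freeS (flip l) g).
  by rewrite (nf_letter_cancel Sl st) /= -[X in f X (f _ _)]flipK fK.
by rewrite (nf_letter_keep Sl st).
Qed.

Lemma letter_action_is_action : is_action letter_action.
Proof.
split=> [x|g h x]; first by rewrite /letter_action nf1.
have [Sg _ {1}<-] := nfP freeS g; rewrite {2}/letter_action.
elim: (nf freeS g) Sg => [|l w IH] Sw /=; first by rewrite word_val_nil mul1g.
rewrite word_val_cons -mulgA letter_action_letter ?IH //.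
  by move=> m mw; apply: Sw; rewrite inE mw orbT.
by apply: Sw; rewrite inE eqxx.
Qed.

End LetterAction.

Section Freeness.
Local Open Scope group_scope.
Variables (D : groupType) (X : Type) (b : D -> X -> X).
Hypothesis b1 : forall x, b 1 x = x.
Hypothesis bM : forall g h x, b (g * h) x = b g (b h x).
Hypothesis b_free : forall g x, b g x = x -> g = 1.
Variables (P : nat -> set D) (h : nat -> D).
Hypothesis P1 : forall i, ~ P i 1.
Hypothesis Pdisj : forall i j x, P i x -> P j x -> i = j.
Hypothesis hP :
  forall n, pingpong (P (side (n, false))) (P (side (n, true))) (h n).

Let I : set nat := [set n | ~~ odd n].

Variables (t t' : X -> X).
Hypothesis tK : cancel t t'.
Hypothesis tK' : cancel t' t.
Hypothesis tI : forall x, exists2 g, generated h I g & b g x = t x.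
Hypothesis t_aperiodic : forall x m, (0 < m)%N -> iter m t x <> x.

Variables (G : groupType) (S : set G) (gamma : G) (iota : G -> nat).
Hypothesis iota_inj : forall s s', S s -> S s' -> iota s = iota s' -> s = s'.

(** The [h n] with odd [n] belong to the letters other than [gamma]. *)
Definition code (l : G * bool) : nat * bool := ((iota l.1).*2.+1, l.2).

Definition free_letter (l : G * bool) (x : X) : X :=
  if l.1 == gamma then (if l.2 then t' x else t x) else b (power h (code l)) x.

Lemma free_letterK l x : free_letter (flip l) (free_letter l x) = x.
Proof.
case: l => s e; rewrite /free_letter /flip /=; case: eqP => _.
  by case: e => /=; rewrite ?tK ?tK'.
by rewrite -bM -[X in b X _ = _]/(power h ((code (s, e)).1, ~~ (code (s, e)).2) *
  power h (code (s, e))) power_flip mulVg b1.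
Qed.

Let step e := if e then t' else t.

Lemma step_aperiodic e m x : (0 < m)%N -> iter m (step e) x <> x.
Proof.
case: e => m0 /= per; last exact: t_aperiodic per.
apply: (t_aperiodic (x := x) m0); rewrite -{1}per.
elim: m {m0 per} => //= m IH.
by rewrite -iterS iterSr tK'.
Qed.

Lemma step_generated e m x : exists2 g, generated h I g & b g x = iter m (step e) x.
Proof.
elim: m => [|m [g Ig gx]]; first by exists 1; [exact: generated1|rewrite b1].
have [k Ik kx] : exists2 k, generated h I k & b k (b g x) = step e (b g x).
  case: e gx => gx; last exact: tI.
  have [k Ik kx] := tI (t' (b g x)); exists k^-1; first exact: generated_inv.
  by rewrite -[in LHS](tK' (b g x)) -kx -bM mulVg b1.
by exists (k * g); [exact: generated_mul|rewrite bM kx gx].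
Qed.

Let table_I (g : D) : Prop := exists2 l, I l.1 & P (side l) g.

(** A nonzero power of [t] acts at each point as some nontrivial element of the
    subgroup generated by the [h n] with even [n]. *)
Lemma table_I_power g : ~ table_I g -> forall e m x, (0 < m)%N ->
  exists2 k, table_I k & iter m (step e) (b g x) = b k x.
Proof.
move=> ng e m x m0; have [k Ik kx] := step_generated e m (b g x).
exists (k * g); last by rewrite bM kx.
apply: (generated_pingpong Pdisj hP Ik) => [|l Il Pl]; last by apply: ng; exists l.
apply/eqP => k1; apply: (@step_aperiodic e m (b g x)) => //.
by rewrite -kx k1 b1.
Qed.

(** A block of letters [gamma] is kept as an explicit power of [t], since only
    the block as a whole is known to act as a nontrivial element of the
    subgroup. *)
Let spec (w : seq (G * bool)) (x : X) : Prop :=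
  match w with
  | [::] => True
  | l :: _ => if l.1 == gamma
      then exists g m, [/\ (0 < m)%N, ~ table_I g &
             act_word free_letter w x = iter m (step l.2) (b g x)]
      else exists2 g, P (side (code l)) g & act_word free_letter w x = b g x
  end.

Lemma code_not_I l g : P (side (code l)) g -> ~ table_I g.
Proof.
move=> Pg [k Ik /(Pdisj Pg) /side_inj e]; move: Ik.
by rewrite -e /I /= /code /= odd_double.
Qed.

Lemma words_spec w x : (forall l, l \in w -> S l.1) -> reduced w -> spec w x.
Proof.
elim: w => // l w IH Sw rw.
have {IH} : spec w x.
  by apply: IH; [move=> m mw; apply: Sw; rewrite inE mw orbT|exact: path_sorted rw].
have Sl : S l.1 by apply: Sw; rewrite inE eqxx.
have Sm m : m \in w -> S m.1 by move=> mw; apply: Sw; rewrite inE mw orbT.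
rewrite /spec /=; case: (l.1 =P gamma) => [lg|/eqP lg].
  have fl y : free_letter l y = step l.2 y.
    by rewrite /free_letter lg eqxx /step; case: l.2.
  rewrite fl; case: w rw Sw Sm => [|m w] rw Sw Sm /=.
    move=> _; exists 1, 1%N; rewrite b1; split=> //.
    by move=> [k _ /P1].
  rewrite /act_word /=; case: (m.1 =P gamma) => [mg [g [n [n0 ng e]]]|/eqP mg [g Pg e]].
    exists g, n.+1; split=> //=; rewrite e; congr (step _ _).
    suff -> : l.2 = m.2 by [].
    by move: rw; rewrite /reduced /= lg mg eqxx /= negbK => /andP[/eqP].
  by exists g, 1%N; rewrite e; split=> //; exact: code_not_I Pg.
case: w rw Sw Sm => [|m w] rw Sw Sm /=.
  move=> _; exists (power h (code l)); last by rewrite /free_letter (negbTE lg).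
  rewrite -[power _ _]mulg1; apply: (power_pingpong hP); exact: P1.
have mw : m \in m :: w by rewrite inE eqxx.
suff step_letter g : act_word free_letter (m :: w) x = b g x ->
    ~ P (side ((code l).1, ~~ (code l).2)) g ->
    exists2 g0, P (side (code l)) g0 &
      free_letter l (free_letter m (foldr free_letter x w)) = b g0 x.
  case: (m.1 =P gamma) => [mg [g [n [n0 ng e]]]|/eqP mg [g Pg e]].
    have [k Ik ek] := table_I_power ng m.2 x n0; rewrite ek in e.
    by apply: step_letter e _ => Pk'; exact: (@code_not_I (l.1, ~~ l.2) k Pk' Ik).
  apply: step_letter e _ => Pg'; have := side_inj (Pdisj Pg Pg').
  rewrite /code /= => -[/double_inj /iota_inj e1 e2].
  have e3 : m.1 = l.1 by apply: e1 => //; exact: Sm.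
  by move: rw; rewrite /reduced /= e2 e3 eqxx /=; case: (l.2).
rewrite /act_word /= => -> ng; exists (power h (code l) * g).
  exact: (power_pingpong hP).
by rewrite {1}/free_letter (negbTE lg) bM.
Qed.

(** At each point such a word acts as an element of the table, and the identity
    lies outside the table. *)
Lemma reduced_word_free w x : (forall l, l \in w -> S l.1) -> reduced w ->
  act_word free_letter w x = x -> w = [::].
Proof.
move=> Sw rw; have := words_spec x Sw rw; case: w {Sw rw} => // l w /=.
have contra g i : P i g -> b g x = x -> False by move=> Pg /b_free g1; rewrite g1 in Pg; exact: P1 Pg.
case: (l.1 =P gamma) => [_ [g [m [m0 ng ->]]]|_ [g Pg ->] e]; last by case: (contra _ _ Pg e).
by have [k [k' _ Pk] ->] := table_I_power ng l.2 x m0 => e; case: (contra _ _ Pk e).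
Qed.

End Freeness.

(** * Probability measures with real values *)

Section RealProbability.
Local Open Scope ring_scope.
Context d (T : measurableType d) (R : realType) (mu : probability T R).
Implicit Types A B C : set T.

Definition pr A : R := fine (mu A).

Lemma prE A : measurable A -> mu A = (pr A)%:E.
Proof. by move=> mA; rewrite /pr fineK // fin_num_measure. Qed.

Lemma pr_ge0 A : 0 <= pr A.
Proof. by rewrite fine_ge0. Qed.

Lemma pr0 : pr set0 = 0.
Proof. by rewrite /pr measure0. Qed.

Lemma prT : pr setT = 1.
Proof. by rewrite /pr probability_setT. Qed.

Lemma le_pr A B : measurable A -> measurable B -> A `<=` B -> pr A <= pr B.
Proof.
by move=> mA mB AB; rewrite -lee_fin -!prE // le_measure // inE.
Qed.

Lemma prU A B : measurable A -> measurable B -> A `&` B = set0 ->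
  pr (A `|` B) = pr A + pr B.
Proof.
move=> mA mB AB; apply: EFin_inj; rewrite EFinD -!prE //; last exact: measurableU.
exact: measureU.
Qed.

Lemma prDI A B : measurable A -> measurable B ->
  pr A = pr (A `\` B) + pr (A `&` B).
Proof.
move=> mA mB; apply: EFin_inj; rewrite EFinD -!prE //.
- exact: measureDI.
- exact: measurableI.
- exact: measurableD.
Qed.

Lemma prC A : measurable A -> pr (~` A) = 1 - pr A.
Proof.
by move=> mA; apply: EFin_inj; rewrite EFinB -!prE // ?probability_setC //;
  exact: measurableC.
Qed.

Lemma pr_cover A B C : measurable A -> measurable B -> measurable C ->
  A `<=` B `|` C -> pr A <= pr B + pr C.
Proof.
move=> mA mB mC AB; have mD := measurableD mC mB.
have e : B `|` (C `\` B) = B `|` C.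
  by apply/seteqP; split=> x /=; have := EM (B x); tauto.
apply: (le_trans (le_pr mA (measurableU _ _ mB mC) AB)).
rewrite -e prU //; last by apply/seteqP; split=> x //= [? []].
by rewrite lerD2l le_pr // => x [].
Qed.

Lemma pr_null_sub A B : measurable A -> measurable B -> A `<=` B -> pr B = 0 ->
  pr A = 0.
Proof.
by move=> mA mB AB B0; apply/eqP; rewrite eq_le pr_ge0 -B0 le_pr.
Qed.

Lemma pr_bigcup0 (F : nat -> set T) :
  (forall n, measurable (F n)) -> (forall n, pr (F n) = 0) ->
  pr (\bigcup_n F n) = 0.
Proof.
move=> mF F0; have mU : measurable (\bigcup_n F n) by exact: bigcup_measurable.
suff : mu.-negligible (\bigcup_n F n) by move/negligibleP; rewrite /pr => ->.
by apply: negligible_bigcup => n; apply/negligibleP => //;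
  have := prE (mF n); rewrite F0.
Qed.

Lemma pr_eq_mod0 A B N : measurable A -> measurable B -> measurable N ->
  pr N = 0 -> (forall x, ~ N x -> (A x <-> B x)) -> pr A = pr B.
Proof.
move=> mA mB mN N0 AB.
have le A' B' : measurable A' -> measurable B' ->
    (forall x, ~ N x -> (A' x <-> B' x)) -> pr A' <= pr B'.
  move=> mA' mB' AB'; rewrite -[leRHS]addr0 -N0; apply: pr_cover => // x A'x.
  by have [Nx|/AB' Nx] := EM (N x); [right|left; exact/Nx].
by apply/eqP; rewrite eq_le !le //= => x /AB [].
Qed.

Lemma pr_cvg_up (F : nat -> set T) e : (forall n, measurable (F n)) ->
  (forall n, F n `<=` F n.+1) -> 0 < e ->
  exists n, pr (\bigcup_n F n) < pr (F n) + e.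
Proof.
move=> mF ndF e0; have mU : measurable (\bigcup_n F n) by exact: bigcup_measurable.
have nd : nondecreasing_seq F.
  by apply/nondecreasing_seqP => n; rewrite subsetEset.
have : (mu \o F) n @[n --> \oo] --> (pr (\bigcup_n F n))%:E.
  by rewrite -prE //; exact: nondecreasing_cvg_mu.
move=> /fine_cvg.
move=> /cvgr_gt - /(_ (pr (\bigcup_n F n) - e)); rewrite ltrBlDr ltrDl => /(_ e0).
by case=> n _ /(_ n (leqnn n)); rewrite /= ltrBlDr => h; exists n.
Qed.

Lemma pr_cvg_down (F : nat -> set T) e : (forall n, measurable (F n)) ->
  (forall n, F n.+1 `<=` F n) -> 0 < e ->
  exists n, pr (F n) < pr (\bigcap_n F n) + e.
Proof.
move=> mF niF e0.
have mI : measurable (\bigcap_n F n) by exact: bigcap_measurable.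
have [||//|n hn] := @pr_cvg_up (fun n => ~` F n) e.
- by move=> n; exact: measurableC.
- by move=> n; exact/subsetC.
exists n; rewrite -setC_bigcap !prC // in hn; lra.
Qed.

Definition dist A B : R := pr (A `+` B).

Lemma measurableY A B : measurable A -> measurable B -> measurable (A `+` B).
Proof. by move=> mA mB; apply: measurableU; apply: measurableD. Qed.

Lemma dist_cover A B C D E F :
  measurable A -> measurable B -> measurable C -> measurable D ->
  measurable E -> measurable F ->
  A `+` B `<=` (C `+` D) `|` (E `+` F) -> dist A B <= dist C D + dist E F.
Proof. by move=> *; apply: pr_cover => //; exact: measurableY. Qed.

Lemma distC A B : dist A B = dist B A.
Proof. by rewrite /dist setYC. Qed.

Lemma dist_triangle B A C : measurable A -> measurable B -> measurable C ->
  dist A C <= dist A B + dist B C.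
Proof.
move=> mA mB mC; apply: dist_cover => // x /=.
by have := EM (B x); tauto.
Qed.

Lemma pr_dist A B : measurable A -> measurable B -> pr A <= pr B + dist A B.
Proof.
move=> mA mB; apply: pr_cover => //; first exact: measurableY.
by move=> x /=; have := EM (B x); tauto.
Qed.

(** Sets that are approximated by members of an algebra form a sigma-algebra. *)
Lemma approximation (I : Type) (B : I -> set T) (U : nat -> set T) :
  (forall i, measurable (B i)) ->
  (exists i, B i = set0) ->
  (forall i, exists j, B j = ~` B i) ->
  (forall i j, exists k, B k = B i `|` B j) ->
  (forall n, exists i, B i = U n) ->
  (measurable `<=` <<s range U >>) ->
  forall A, measurable A -> forall e, 0 < e -> exists i, dist A (B i) < e.
Proof.
move=> mB [i0 Bi0] BC BU BgeU gen.
pose good A := measurable A /\ forall e, 0 < e -> exists i, dist A (B i) < e.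
suff sub : <<s range U >> `<=` good by move=> A /gen /sub [].
apply: smallest_sub; last first.
  move=> _ [n _ <-]; have [i <-] := BgeU n; split=> // e e0; exists i.
  by rewrite /dist setYK pr0.
have goodB i : good (B i).
  by split=> // e e0; exists i; rewrite /dist setYK pr0.
have goodC A : good A -> good (~` A).
  move=> [mA hA]; split=> [|e /hA [i di]]; first exact: measurableC.
  have [j ej] := BC i; exists j; rewrite ej.
  suff -> : dist (~` A) (~` B i) = dist A (B i) by [].
  congr (pr _); apply/seteqP; split=> x /=; have := EM (A x);
    have := EM (B i x); tauto.
have goodU A A' : good A -> good A' -> good (A `|` A').
  move=> [mA hA] [mA' hA']; split=> [|e e0]; first exact: measurableU.
  have e20 : 0 < e / 2 by lra.
  have [i di] := hA _ e20; have [j dj] := hA' _ e20; have [k ek] := BU i j.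
  exists k; rewrite ek.
  have : dist (A `|` A') (B i `|` B j) <= dist A (B i) + dist A' (B j).
    apply: dist_cover => //; [exact: measurableU|exact: measurableU|].
    by move=> x /=; have := EM (B i x); have := EM (B j x);
      have := EM (A x); have := EM (A' x); tauto.
  lra.
split.
- by rewrite -Bi0.
- by move=> A /goodC; rewrite setTD.
move=> F gF.
have gG n : good (\bigcup_(i in `I_n) F i).
  elim: n => [|n IH]; first by rewrite II0 bigcup_set0 -Bi0.
  by rewrite IIS bigcup_setU bigcup_set1; apply: goodU.
have mF n : measurable (F n) := (gF n).1.
have mU : measurable (\bigcup_n F n) by exact: bigcup_measurable.
split=> // e e0; have e20 : 0 < e / 2 by lra.
have [||//|n] := @pr_cvg_up (fun n => \bigcup_(i in `I_n) F i) (e / 2).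
- by move=> n; have [] := gG n.
- by move=> n x [i /= lin Fi]; exists i => //=; exact: ltnW.
have -> : \bigcup_n \bigcup_(i in `I_n) F i = \bigcup_n F n.
  apply/seteqP; split=> x; first by move=> [m _ [k _ Fk]]; exists k.
  by move=> [k _ Fk]; exists k.+1 => //; exists k => /=.
have [mG hG] := gG n; have [i di] := hG _ e20; move=> hn; exists i.
have := dist_triangle mU mG (mB i).
suff : dist (\bigcup_n F n) (\bigcup_(i in `I_n) F i) < e / 2 by lra.
have sub : \bigcup_(i in `I_n) F i `<=` \bigcup_n F n.
  by move=> x [k _ Fk]; exists k.
have := prDI mU mG; rewrite setIidr // /dist /setY (_ : _ `\` \bigcup_n F n = set0).
  by rewrite setU0; lra.
by apply/seteqP; split=> x //= [/sub].
Qed.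

Definition automorphism (f : T -> T) : Prop := exists g : T -> T,
  [/\ cancel f g, cancel g f, measurable_fun setT f & measurable_fun setT g].

Lemma measurable_preimage (f : T -> T) A :
  measurable_fun setT f -> measurable A -> measurable (f @^-1` A).
Proof. by move=> mf mA; rewrite -[_ @^-1` _]setTI; exact: mf. Qed.

Lemma automorphism_id : automorphism id.
Proof. by exists id; split=> //; exact: measurable_id. Qed.

Lemma automorphism_comp f g : automorphism f -> automorphism g ->
  automorphism (f \o g).
Proof.
move=> [f' [fK f'K mf mf']] [g' [gK g'K mg mg']]; exists (g' \o f'); split.
- exact: can_comp.
- exact: can_comp.
- exact: measurableT_comp.
- exact: measurableT_comp.
Qed.

End RealProbability.

(** * Countable bases of standard Borel spaces *)

Section CountablyGenerated.
Local Open Scope ring_scope.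
Context d (T : measurableType d).

Definition standard_base (U : nat -> set T) : Prop :=
  [/\ forall n, measurable (U n),
      measurable `<=` <<s range U >> &
      forall x y, (forall n, U n x <-> U n y) -> x = y].

Variable U : nat -> set T.
Hypothesis baseU : standard_base U.

(** Boolean combinations are kept in disjunctive normal form, so that they are
    indexed by a countable type. *)
Definition literal (l : nat * bool) : set T :=
  if l.2 then ~` U l.1 else U l.1.

Definition conjunction (c : seq (nat * bool)) : set T :=
  [set x | forall l, l \in c -> literal l x].

Definition dnf (L : seq (seq (nat * bool))) : set T :=
  [set x | exists2 c, c \in L & conjunction c x].

Lemma conjunction_cons l c :
  conjunction (l :: c) = literal l `&` conjunction c.
Proof.
apply/seteqP; split=> x /=.
  by move=> h; split=> [|m mc]; apply: h; rewrite inE ?eqxx ?mc ?orbT.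
by move=> [h1 h2] m; rewrite inE => /orP[/eqP ->//|/h2].
Qed.

Lemma conjunction_cat c c' :
  conjunction (c ++ c') = conjunction c `&` conjunction c'.
Proof.
apply/seteqP; split=> x /=.
  by move=> h; split=> l lc; apply: h; rewrite mem_cat lc ?orbT.
by move=> [h1 h2] l; rewrite mem_cat => /orP[/h1|/h2].
Qed.

Lemma dnf_cons c L : dnf (c :: L) = conjunction c `|` dnf L.
Proof.
apply/seteqP; split=> x /=.
  move=> [c' ]; rewrite inE => /orP[/eqP ->|c'L cx]; first by left.
  by right; exists c'.
move=> [cx|[c' c'L cx]]; first by exists c; rewrite ?inE ?eqxx.
by exists c'; rewrite ?inE ?c'L ?orbT.
Qed.

Lemma dnf_cat L L' : dnf (L ++ L') = dnf L `|` dnf L'.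
Proof.
apply/seteqP; split=> x /=.
  by move=> [c]; rewrite mem_cat => /orP[cL|cL] cx; [left|right]; exists c.
by move=> [[c cL cx]|[c cL cx]]; exists c => //; rewrite mem_cat cL ?orbT.
Qed.

Lemma dnfI L L' : exists L2, dnf L2 = dnf L `&` dnf L'.
Proof.
exists [seq c ++ c' | c <- L, c' <- L']; apply/seteqP; split=> x /=.
  move=> [_ /allpairsP[[c c'] /= [cL cL' ->]]]; rewrite conjunction_cat.
  by move=> [h1 h2]; split; [exists c|exists c'].
move=> [[c cL cx] [c' cL' cx']]; exists (c ++ c').
  by apply/allpairsP; exists (c, c').
by rewrite conjunction_cat.
Qed.

Lemma conjunctionC c : exists L, dnf L = ~` conjunction c.
Proof.
elim: c => [|l c [L eL]].
  exists [::]; apply/seteqP; split=> x /=; first by move=> [].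
  by move=> [].
exists ([:: (l.1, ~~ l.2)] :: L).
have e0 : conjunction [::] = setT by apply/seteqP; split.
rewrite dnf_cons eL !conjunction_cons e0 setIT setCI; congr (_ `|` _).
by rewrite /literal /=; case: l.2 => //=; rewrite setCK.
Qed.

Lemma dnfC L : exists L', dnf L' = ~` dnf L.
Proof.
elim: L => [|c L [L1 e1]].
  exists [:: [::]]; apply/seteqP; split=> x /=; first by move=> _ [].
  by move=> _; exists [::].
have [L2 e2] := conjunctionC c; have [L3 e3] := dnfI L2 L1.
by exists L3; rewrite e3 e2 e1 dnf_cons setCU.
Qed.

Lemma measurable_conjunction c : measurable (conjunction c).
Proof.
have [mU _ _] := baseU; elim: c => [|l c IH].
  rewrite (_ : conjunction _ = setT); first exact: measurableT.
  by apply/seteqP; split.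
rewrite conjunction_cons; apply: measurableI => //; rewrite /literal.
by case: l.2 => //; exact: measurableC.
Qed.

Lemma measurable_dnf L : measurable (dnf L).
Proof.
elim: L => [|c L IH].
  rewrite (_ : dnf _ = set0); first exact: measurable0.
  by apply/seteqP; split=> x //= [].
by rewrite dnf_cons; apply: measurableU => //; exact: measurable_conjunction.
Qed.

Lemma point_conjunctions x :
  \bigcap_k conjunction [seq (i, `[< ~ U i x >]) | i <- iota 0 k] = [set x].
Proof.
have [_ _ sepU] := baseU.
have key y k : conjunction [seq (i, `[< ~ U i x >]) | i <- iota 0 k] y <->
    (forall i, (i < k)%N -> (U i y <-> U i x)).
  rewrite /conjunction /literal /=; split=> h.
    move=> i ik; have := h (i, `[< ~ U i x >]); rewrite map_f; last first.
      by rewrite mem_iota.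
    by move=> /(_ isT) /=; case: asboolP => // /contrapT.
  move=> _ /mapP[i + ->] /=; rewrite mem_iota => /= /h.
  by case: asboolP => [? []|/contrapT ? []] //=; tauto.
apply/seteqP; split=> y /=.
  by move=> h; apply: sepU => n; apply: (key y n.+1).1 => //; exact: h.
by move=> -> k _; apply/key.
Qed.

Lemma measurable_point (x : T) : measurable [set x].
Proof.
rewrite -point_conjunctions; apply: bigcap_measurable => // k _.
exact: measurable_conjunction.
Qed.

Variables (R : realType) (mu : probability T R).

(** The boolean combinations of the sets of a base form a countable algebra. *)
Lemma approximation_dnf (A : set T) e : measurable A -> 0 < e ->
  exists L, dist mu A (dnf L) < e.
Proof.
have [mU gU sepU] := baseU => mA e0.
apply: (@approximation _ _ _ mu _ dnf U) => //.
- exact: measurable_dnf.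
- by exists [::]; apply/seteqP; split=> x //= [].
- exact: dnfC.
- by move=> L L'; exists (L ++ L'); exact: dnf_cat.
- move=> n; exists [:: [:: (n, false)]]; apply/seteqP; split=> x /=.
    by move=> [c]; rewrite inE => /eqP -> /(_ (n, false)); apply; rewrite inE.
  move=> Ux; exists [:: (n, false)]; first by rewrite inE.
  by move=> l; rewrite inE => /eqP ->.
Qed.

(** The sets given by more and more coordinates of a point shrink to it. *)
Lemma small_neighbourhood (x : T) e : pr mu [set x] = 0 -> 0 < e ->
  exists c, conjunction c x /\ pr mu (conjunction c) < e.
Proof.
move=> x0 e0; pose c k := [seq (i, `[< ~ U i x >]) | i <- iota 0 k].
have [||//|k] := @pr_cvg_down _ _ _ mu (fun k => conjunction (c k)) e.
- by move=> k; exact: measurable_conjunction.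
- move=> k y h l /mapP[i]; rewrite mem_iota add0n => /= ik el; apply: h.
  by rewrite el map_f // mem_iota add0n leq0n ltnS ltnW.
have ex : \bigcap_k conjunction (c k) = [set x] by exact: point_conjunctions.
rewrite ex x0 add0r => ck; exists (c k); split=> //.
have : [set x] x by [].
by rewrite -ex => /(_ k I).
Qed.

(** Members of a base are added one by one as long as the measure stays below
    [t]. A point that is left out has a small neighbourhood that should have
    been added. *)
Lemma subset_of_measure (D : set T) t : (forall x, pr mu [set x] = 0) -> measurable D ->
  0 <= t <= pr mu D -> exists D', [/\ measurable D', D' `<=` D & pr mu D' = t].
Proof.
move=> points0 mD /andP[t0 tD].
pose V n := conjunction (odflt [::] (unpickle n)).
have mV n : measurable (V n) by exact: measurable_conjunction.
pose add n A := if pr mu (A `|` (D `&` V n)) <= t then A `|` (D `&` V n) else A.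
pose A := fix A n := if n is n.+1 then add n (A n) else set0.
have mA n : measurable (A n).
  elim: n => //= n IH; rewrite /add; case: ifP => // _.
  by apply: measurableU => //; exact: measurableI.
have At n : pr mu (A n) <= t.
  by elim: n => /= [|n IH]; rewrite ?pr0 // /add; case: ifP.
have nA n : A n `<=` A n.+1 by rewrite /= /add; case: ifP => _ x Ax //; left.
have AD n : A n `<=` D.
  by elim: n => //= n IH; rewrite /add; case: ifP => // _ x [/IH|[]].
pose A' := \bigcup_n A n.
have mA' : measurable A' by exact: bigcup_measurable.
exists A'; split=> //; first by move=> x [n _ /AD].
apply/eqP; rewrite eq_le; apply/andP; split.
  apply/ler_addgt0Pr => e e0; have [n] := pr_cvg_up mu mA nA e0.
  by rewrite -/A' => h; have := At n; lra.
rewrite leNgt; apply/negP => lt; have e0 : 0 < t - pr mu A' by lra.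
suff /(le_pr mu mD mA') : D `<=` A' by lra.
move=> x Dx; have [c [cx ce]] := small_neighbourhood (points0 x) e0.
exists (pickle c).+1 => //=; rewrite /add /V pickleK /=; case: ifP => [_|/negP[]].
  by right.
apply: (@le_trans _ _ (pr mu A' + pr mu (conjunction c))); last by lra.
apply: pr_cover => //.
- apply: measurableU => //; apply: measurableI => //; exact: measurable_conjunction.
- exact: measurable_conjunction.
by move=> y [Ay|[_ cy]]; [left; exists (pickle c)|right].
Qed.

End CountablyGenerated.

Section PolishBase.
Local Open Scope ring_scope.
Variables (R : realType) (X : ptopologicalType).

(** The balls of radius [1 / (k + 1)] around the points of a countable dense
    set form a countable base of the topology. *)
Lemma polish_standard_base : polish R X ->
  exists U : nat -> set (borel X), standard_base U.
Proof.
move=> [[D cD dD] [dst [[d0 dE dC dtri] compat _]]].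
have [f injf] := countable_injP D cD.
pose ball x e := [set y | dst x y < e].
have openb x e : open (ball x e : set X).
  apply/compat => y yb; exists (e - dst x y); first by rewrite subr_gt0.
  by move=> z /= zy; have := dtri x y z; rewrite /ball /= in yb zy *; lra.
pose U (n : nat) : set X := let (m, k) := odflt (0%N, 0%N) (unpickle n) in
  [set z | exists y, [/\ D y, f y = m & dst y z < k.+1%:R^-1]].
have openU n : open (U n).
  rewrite /U; case: (odflt _ _) => m k.
  rewrite (_ : [set _ | _] =
      \bigcup_(y in [set y | D y /\ f y = m]) ball y k.+1%:R^-1).
    by apply: bigcup_open => y _.
  by apply/seteqP; split=> z; [move=> [y [? ? ?]]; exists y|
    move=> [y [? ?] ?]; exists y].
have baseU x (O : set X) : open O -> O x -> exists n, U n x /\ U n `<=` O.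
  move=> /compat oO /oO [e e0 be].
  have [k ke] : exists k : nat, k.+1%:R^-1 < e / 2.
    have e20 : 0 < e / 2 by lra.
    have /cvgr_lt /(_ _ e20) [k _ /(_ k (leqnn k)) hk] := @cvg_harmonic R.
    by exists k.
  have k0 : 0 < (k.+1%:R^-1 : R) by rewrite invr_gt0 ltr0n.
  have [y [Dy yx]] : D `&` ball x k.+1%:R^-1 !=set0.
    rewrite setIC; apply: dD; last exact: openb.
    by exists x; rewrite /ball /= (dE x x).2.
  exists (pickle (f y, k)); rewrite /U pickleK /=; split.
    by exists y; split=> //; rewrite dC.
  move=> z [y' [Dy' fy' y'z]]; have ey : y' = y.
    by apply: injf => //; rewrite inE.
  rewrite {y' Dy' fy'}ey in y'z.
  by apply: be => /=; have := dtri x y z; rewrite /ball /= in yx *; move: (k.+1%:R^-1) ke yx y'z => i *; lra.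
exists U; split.
- by move=> n; apply: sub_sigma_algebra; exact: openU.
- apply: smallest_sub; first exact: smallest_sigma_algebra.
  move=> O oO.
  rewrite (_ : O = \bigcup_n (if `[< U n `<=` O >] then U n else set0)).
    have [s0 _ sU] : sigma_algebra setT <<s range U >>.
      exact: smallest_sigma_algebra.
    apply: sU => n; case: asboolP => // _; apply: sub_sigma_algebra.
    by exists n.
  apply/seteqP; split=> x.
    move=> Ox; have [n [Ux UO]] := baseU _ _ oO Ox; exists n => //.
    by case: asboolP.
  by move=> [n _]; case: asboolP => // UO /UO.
move=> x y xy; apply: contrapT => nxy.
have dxy : 0 < dst x y.
  by rewrite lt_neqAle d0 andbT eq_sym; apply/eqP => /dE.
have [|n [Ux UO]] := baseU x _ (openb x (dst x y)).
  by rewrite /ball /= (dE x x).2.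
by have := UO _ ((xy n).1 Ux); rewrite /ball /= ltxx.
Qed.

End PolishBase.

(** * Ergodic subgroups *)

Lemma enumeration (T : Type) (A : set T) (x0 : T) : A x0 -> countable A ->
  exists e : nat -> T, (forall n, A (e n)) /\ (forall x, A x -> exists n, e n = x).
Proof.
move=> Ax0 /countable_injP[f injf].
have [e he] : {e : nat -> T & forall n, A (e n) /\
    ((exists2 x, A x & f x = n) -> f (e n) = n)}.
  apply: (@choice _ _ (fun n x => A x /\ ((exists2 y, A y & f y = n) -> f x = n))).
  move=> n; have [[x Ax fx]|no] := EM (exists2 y, A y & f y = n).
    by exists x.
  by exists x0.
exists e; split=> [n|x Ax]; first by have [] := he n.
exists (f x); have [Ae] := he (f x); move=> /(_ (ex_intro2 _ _ x Ax erefl)) ex.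
by apply: injf => //; rewrite inE.
Qed.

Section ErgodicSelection.
Local Open Scope ring_scope.
Context d (T : measurableType d) (R : realType) (mu : probability T R).
Variables (G : groupType) (b : G -> T -> T).
Hypothesis b1 : forall x, b 1%g x = x.
Hypothesis bM : forall g h x, b (g * h)%g x = b g (b h x).
Hypothesis mb : forall g, measurable_fun setT (b g).
Hypothesis pres : forall g A, measurable A -> pr mu (b g @^-1` A) = pr mu A.

Definition displacement (g : G) (A : set T) : R := dist mu (b g @^-1` A) A.

Lemma dist_preimage g A B : measurable A -> measurable B ->
  dist mu (b g @^-1` A) (b g @^-1` B) = dist mu A B.
Proof. by move=> mA mB; rewrite /dist -(pres g (measurableY mA mB)). Qed.

Lemma displacementM g h A : measurable A ->
  displacement (g * h)%g A <= displacement g A + displacement h A.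
Proof.
move=> mA; have mP k B : measurable B -> measurable (b k @^-1` B).
  exact: measurable_preimage.
rewrite /displacement -(dist_preimage h (mP g A mA) mA).
rewrite (_ : b (g * h)%g @^-1` A = b h @^-1` (b g @^-1` A)).
  by apply: dist_triangle; do ?apply: (mP _).
by apply/seteqP; split=> x; rewrite /= bM.
Qed.

Lemma displacementV g A : measurable A ->
  displacement g^-1%g A = displacement g A.
Proof.
move=> mA; rewrite /displacement -(dist_preimage g) //; last first.
  exact: measurable_preimage.
rewrite (_ : b g @^-1` (b g^-1%g @^-1` A) = A); first exact: distC.
by apply/seteqP; split=> x; rewrite /= -bM mulVg b1.
Qed.

Lemma displacement_ge0 g A : 0 <= displacement g A.
Proof. exact: pr_ge0. Qed.

Lemma displacement_approx g A B : measurable A -> measurable B ->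
  displacement g A <= displacement g B + 2 * dist mu A B.
Proof.
move=> mA mB; have mP C : measurable C -> measurable (b g @^-1` C).
  exact: measurable_preimage.
have h1 := dist_triangle mu (mP _ mA) (mP _ mB) mA.
have h2 := dist_triangle mu (mP _ mB) mB mA.
by rewrite dist_preimage // (distC mu B A) in h1 h2 *; rewrite /displacement; lra.
Qed.

(** Displacement is a length function on the group, so an element cannot move
    a set much if [r], [p * r] and [p * g * r] all move it little. *)
Lemma displacement_sandwich g p r A : measurable A ->
  exists k, [\/ k = r, k = (p * r)%g | k = (p * g * r)%g] /\
    displacement g A <= 4 * displacement k A.
Proof.
move=> mA; apply: contrapT => no.
have small k : [\/ k = r, k = (p * r)%g | k = (p * g * r)%g] ->
    displacement k A < displacement g A / 4.
  move=> hk; rewrite ltNge; apply/negP => le; apply: no; exists k; split=> //; lra.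
have h1 := small r (Or31 _ _ erefl); have h2 := small _ (Or32 _ _ erefl).
have h3 := small _ (Or33 _ _ erefl).
have h4 := displacementM (p * r)%g r^-1%g mA.
have h5 := displacementM (p * g * r)%g r^-1%g mA.
have h6 := displacementM p^-1%g (p * g)%g mA.
rewrite mulgK in h4; rewrite mulgK in h5; rewrite mulgA mulVg mul1g in h6.
by rewrite !displacementV // in h4 h5 h6; lra.
Qed.

Hypothesis ergodicG : forall A, measurable A ->
  (forall g x, A x <-> A (b g x)) -> pr mu A = 0 \/ pr mu (~` A) = 0.
Hypothesis countableG : countable [set: G].
Variable U : nat -> set T.
Hypothesis baseU : standard_base U.

(** A set that is invariant up to null sets differs by a null set from the
    intersection of its translates, which is invariant. *)
Lemma ergodic_ae_invariant A : measurable A ->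
  (forall g, displacement g A = 0) -> pr mu A = 0 \/ pr mu (~` A) = 0.
Proof.
move=> mA A0; have [e [_ eG]] := enumeration (x0 := 1%g) I countableG.
pose A' := \bigcap_n (b (e n) @^-1` A); pose N := \bigcup_n (b (e n) @^-1` A `+` A).
have mP n : measurable (b (e n) @^-1` A) by exact: measurable_preimage.
have mA' : measurable A' by exact: bigcap_measurable.
have mN : measurable N by apply: bigcup_measurable => n _; exact: measurableY.
have N0 : pr mu N = 0.
  by apply: pr_bigcup0 => n; [exact: measurableY|exact: A0].
have AA' x : ~ N x -> (A x <-> A' x).
  move=> Nx; have Nn n : A (b (e n) x) <-> A x.
    have := EM (A (b (e n) x)); have := EM (A x).
    by have : ~ (b (e n) @^-1` A `+` A) x; [move=> h; apply: Nx; exists n|];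
      move=> /=; tauto.
  split=> [Ax n _|A'x]; first exact/Nn.
  by apply/(Nn 0%N); exact: A'x.
have invA' g x : A' x <-> A' (b g x).
  have inv1 h y : A' y -> A' (b h y).
    move=> A'y n _ /=; rewrite -bM; have [m <-] := eG (e n * h)%g I; exact: A'y.
  by split=> [/inv1 //|/(inv1 g^-1%g)]; rewrite -bM mulVg b1.
have -> : pr mu A = pr mu A' by exact: (@pr_eq_mod0 _ _ _ mu _ _ N).
have -> : pr mu (~` A) = pr mu (~` A').
  apply: (@pr_eq_mod0 _ _ _ mu _ _ N) => // [||x /AA' /=]; last by tauto.
    exact: measurableC.
  exact: measurableC.
exact: ergodicG.
Qed.

(** A sequence of admissible elements acts ergodically as soon as the [n]-th
    one moves the [n]-th pair (set of the algebra, group element) comparably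
    well: sets of the algebra approximate every invariant set. *)
Theorem ergodic_selection (C : nat -> G -> Prop) :
  (forall n g, exists p r, [/\ C n r, C n (p * r)%g & C n (p * g * r)%g]) ->
  exists k : nat -> G, (forall n, C n (k n)) /\
    (forall A, measurable A -> (forall n x, A x <-> A (b (k n) x)) ->
      pr mu A = 0 \/ pr mu (~` A) = 0).
Proof.
move=> hC; have [e [_ eG]] := enumeration (x0 := 1%g) I countableG.
pose index n := odflt ([::], 0%N) (unpickle n) : seq (seq (nat * bool)) * nat.
have [k hk] : {k : nat -> G & forall n, C n (k n) /\
    displacement (e (index n).2) (dnf U (index n).1)
      <= 4 * displacement (k n) (dnf U (index n).1)}.
  apply: (@choice _ _ (fun n k => C n k /\
    displacement (e (index n).2) (dnf U (index n).1)
      <= 4 * displacement k (dnf U (index n).1))) => n.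
  have [p [r [C1 C2 C3]]] := hC n (e (index n).2).
  have [k [hk dk]] := displacement_sandwich (e (index n).2) p r
    (measurable_dnf baseU (index n).1).
  by exists k; split=> //; case: hk => ->.
exists k; split=> [n|A mA invA]; first by have [] := hk n.
apply: ergodic_ae_invariant => // g; apply/eqP; rewrite eq_le displacement_ge0 andbT.
apply/ler_addgt0Pr => eps eps0; rewrite add0r.
have [|L dL] := approximation_dnf baseU mu mA (e := eps / 10); first by lra.
have [i ei] := eG g I; have [_] := hk (pickle (L, i)).
rewrite /index pickleK /= ei => h.
have mL := measurable_dnf baseU L.
have kA : displacement (k (pickle (L, i))) A = 0.
  rewrite /displacement /dist (_ : _ @^-1` A = A) ?setYK ?pr0 //.
  by apply/seteqP; split=> x /=; [exact: (invA _ x).2|exact: (invA _ x).1].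
have h1 := displacement_approx g mA mL.
have h2 := displacement_approx (k (pickle (L, i))) mL mA.
by rewrite (distC mu (dnf U L)) in h2; lra.
Qed.

End ErgodicSelection.

(** * Means of bounded functions *)

Section BoundedIntegral.
Local Open Scope ring_scope.
Context d (T : measurableType d) (R : realType) (mu : probability T R).
Implicit Types f g : T -> R.

Definition bounded_measurable f : Prop :=
  measurable_fun setT f /\ exists M, forall x, `|f x| <= M.

Definition mean f : R := \int[mu]_x f x.

Lemma bounded_measurable_cst c : bounded_measurable (fun=> c).
Proof. by split; [exact: measurable_cst|exists `|c|]. Qed.

Lemma bounded_measurableD f g : bounded_measurable f -> bounded_measurable g ->
  bounded_measurable (fun x => f x + g x).
Proof.
move=> [mf [M bf]] [mg [N bg]]; split; first exact: measurable_funD.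
by exists (M + N) => x; rewrite (le_trans (ler_normD _ _)) // lerD.
Qed.

Lemma bounded_measurableM f g : bounded_measurable f -> bounded_measurable g ->
  bounded_measurable (fun x => f x * g x).
Proof.
move=> [mf [M bf]] [mg [N bg]]; split; first exact: measurable_funM.
by exists (M * N) => x; rewrite normrM ler_pM.
Qed.

Lemma bounded_measurable_comp f (h : T -> T) : measurable_fun setT h ->
  bounded_measurable f -> bounded_measurable (fun x => f (h x)).
Proof.
move=> mh [mf [M bf]]; split; first exact: measurableT_comp.
by exists M.
Qed.

Lemma bounded_measurable_indic (A : set T) : measurable A ->
  bounded_measurable (\1_A : T -> R).
Proof.
move=> mA; split; first exact: measurable_indic.
by exists 1 => x; rewrite indicE; case: (_ \in _); rewrite ?normr1 ?normr0.
Qed.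

Lemma bounded_measurable_integrable f : bounded_measurable f ->
  mu.-integrable setT (EFin \o f).
Proof.
move=> [mf [M bf]]; apply: measurable_bounded_integrable => //.
  by rewrite (_ : _ setT = 1%E) ?ltry //; exact: probability_setT.
exists M; split; first exact: num_real.
by move=> N MN x _; rewrite /= (le_trans (bf x)) // ltW.
Qed.

Lemma meanD f g : bounded_measurable f -> bounded_measurable g ->
  mean (fun x => f x + g x) = mean f + mean g.
Proof.
by move=> bf bg; rewrite /mean RintegralD //; exact: bounded_measurable_integrable.
Qed.

Lemma meanZ c f : bounded_measurable f -> mean (fun x => c * f x) = c * mean f.
Proof.
by move=> bf; rewrite /mean RintegralZl //; exact: bounded_measurable_integrable.
Qed.

Lemma le_mean f g : bounded_measurable f -> bounded_measurable g ->
  (forall x, f x <= g x) -> mean f <= mean g.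
Proof.
by move=> bf bg fg; apply: le_Rintegral => //; exact: bounded_measurable_integrable.
Qed.

Lemma mean_indic (A : set T) : measurable A -> mean \1_A = pr mu A.
Proof.
by move=> mA; rewrite /mean /Rintegral integral_indic // setIT.
Qed.

Lemma mean_comp f (h : T -> T) : measurable_fun setT h ->
  (forall A, measurable A -> pr mu (h @^-1` A) = pr mu A) ->
  bounded_measurable f -> mean (fun x => f (h x)) = mean f.
Proof.
move=> mh ph bf; rewrite /mean /Rintegral; congr fine.
have := @integral_pushforward _ _ _ _ _ h mh mu setT (EFin \o f).
rewrite preimage_setT => <- //.
- apply: eq_measure_integral => A mA _.
  apply: (etrans (prE mu (measurable_preimage mh mA))).
  by apply: (etrans _ (esym (prE mu mA))); rewrite ph.
- by apply/measurable_EFinP; case: bf.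
- apply: (@bounded_measurable_integrable (fun x => f (h x))).
  exact: bounded_measurable_comp.
Qed.

Lemma le_mean_mod0 f g (N : set T) : measurable N -> pr mu N = 0 ->
  bounded_measurable f -> bounded_measurable g ->
  (forall x, ~ N x -> f x <= g x) -> mean f <= mean g.
Proof.
move=> mN N0 bf bg fg; have [_ [M bM]] := bf; have [_ [M' bM']] := bg.
have bN := bounded_measurable_indic mN.
have bMN := bounded_measurableM (bounded_measurable_cst (M + M')) bN.
have -> : mean g = mean (fun x => g x + (M + M') * \1_N x).
  by rewrite meanD // meanZ // mean_indic // N0 mulr0 addr0.
apply: le_mean => //; first exact: bounded_measurableD.
move=> x; rewrite indicE; have [Nx|Nx] := EM (N x).
  rewrite mem_set // mulr1; have := bM x; have := bM' x.
  by rewrite !ler_norml => /andP[? ?] /andP[? ?]; lra.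
by rewrite memNset // mulr0 addr0 fg.
Qed.

Lemma mean_eq_mod0 f g (N : set T) : measurable N -> pr mu N = 0 ->
  bounded_measurable f -> bounded_measurable g ->
  (forall x, ~ N x -> f x = g x) -> mean f = mean g.
Proof.
move=> mN N0 bf bg fg.
by apply/eqP; rewrite eq_le !(le_mean_mod0 mN N0) //= => x Nx; rewrite fg.
Qed.

End BoundedIntegral.

(** * Matchings along the orbits of an ergodic group *)

Section FullGroup.
Local Open Scope ring_scope.
Context d (T : measurableType d) (R : realType) (mu : probability T R).
Variables (F : T -> T -> Prop) (kappa : nat -> T -> T).
Hypothesis equivF : Equivalence F.
Hypothesis kappa_aut : forall n, automorphism (kappa n).
Hypothesis kappaF : forall x y, F x y <-> exists n, kappa n x = y.
Hypothesis presF : forall f, automorphism f -> (forall x, F x (f x)) ->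
  forall A, measurable A -> pr mu (f @^-1` A) = pr mu A.
Hypothesis ergodicF : forall A, measurable A ->
  (forall x y, F x y -> A x -> A y) -> pr mu A = 0 \/ pr mu (~` A) = 0.

Lemma F_refl x : F x x. Proof. exact: Equivalence_Reflexive. Qed.
Lemma F_sym x y : F x y -> F y x. Proof. exact: Equivalence_Symmetric. Qed.
Lemma F_trans y x z : F x y -> F y z -> F x z.
Proof. exact: Equivalence_Transitive. Qed.

Definition invariant (A : set T) : Prop := forall x y, F x y -> A x -> A y.

Definition null_invariant (N : set T) : Prop :=
  [/\ measurable N, pr mu N = 0 & invariant N].

Definition saturation (A : set T) : set T := \bigcup_n (kappa n @^-1` A).

Lemma kappa_in n x : F x (kappa n x).
Proof. by apply/kappaF; exists n. Qed.

Lemma measurable_kappa n : measurable_fun setT (kappa n).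
Proof. by have [g []] := kappa_aut n. Qed.

Lemma measurable_saturation A : measurable A -> measurable (saturation A).
Proof.
move=> mA; apply: bigcup_measurable => n _.
exact/measurable_preimage/mA/measurable_kappa.
Qed.

Lemma saturation_invariant A : invariant (saturation A).
Proof.
move=> x y xy [n _ Anx]; have [m ym] := (kappaF y (kappa n x)).1
  (F_trans (F_sym xy) (kappa_in n x)).
by exists m => //=; rewrite ym.
Qed.

Lemma sub_saturation A : A `<=` saturation A.
Proof.
by move=> x Ax; have [n xn] := (kappaF x x).1 (F_refl x); exists n => //=; rewrite xn.
Qed.

(** This is how exceptional null sets are made invariant, so that they can be
    removed from the space together with their orbits. *)
Lemma saturation_null A : measurable A -> pr mu A = 0 ->
  null_invariant (saturation A).
Proof.
move=> mA A0; split; first exact: measurable_saturation.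
  apply: pr_bigcup0 => n; first exact/measurable_preimage/mA/measurable_kappa.
  by rewrite presF //; exact: kappa_in.
exact: saturation_invariant.
Qed.

Lemma null_invariant_bigcup (N : nat -> set T) :
  (forall n, null_invariant (N n)) -> null_invariant (\bigcup_n N n).
Proof.
move=> nN; split.
- by apply: bigcup_measurable => n _; have [] := nN n.
- by apply: pr_bigcup0 => n; have [] := nN n.
- by move=> x y xy [n _ Nx]; exists n => //; have [_ _ h] := nN n; exact: h xy Nx.
Qed.

Lemma null_invariantU N N' : null_invariant N -> null_invariant N' ->
  null_invariant (N `|` N').
Proof.
move=> [mN N0 iN] [mN' N0' iN']; split; first exact: measurableU.
  apply/eqP; rewrite eq_le pr_ge0 andbT -[leRHS]addr0 -{2}N0' -N0.
  by apply: pr_cover => //; exact: measurableU.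
by move=> x y xy [/(iN _ _ xy)|/(iN' _ _ xy)]; [left|right].
Qed.

Lemma involution_automorphism (f : T -> T) :
  involutive f -> measurable_fun setT f -> automorphism f.
Proof. by exists f; split. Qed.

(** Points of [A] and [B] are matched along [kappa 0], [kappa 1], ... in turn.
    No pair of unmatched points is related by [F], so ergodicity makes the
    unmatched parts, which have the same measure, null. *)
Lemma matching (A B : set T) : measurable A -> measurable B -> A `&` B = set0 ->
  pr mu A = pr mu B ->
  exists phi N, [/\ measurable_fun setT phi, involutive phi,
    forall x, F x (phi x), null_invariant N &
    (forall x, ~ N x -> (A x <-> B (phi x))) /\
    (forall x, ~ A x -> ~ B x -> phi x = x)].
Proof.
move=> mA mB AB prAB; have disj x : A x -> B x -> False.
  by move=> Ax Bx; have : (A `&` B) x by []; rewrite AB.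
have [kappa' hk] := choice kappa_aut.
have kK n : cancel (kappa n) (kappa' n) by have [] := hk n.
have kK' n : cancel (kappa' n) (kappa n) by have [] := hk n.
have mk n := measurable_kappa n.
have mk' n : measurable_fun setT (kappa' n) by have [] := hk n.
pose P n (S : set T * set T) := S.1 `&` (kappa n @^-1` S.2).
pose step n S := (S.1 `\` P n S, S.2 `\` (kappa' n @^-1` P n S)).
(* [S n] is the pair of sets of points that are still unmatched at time [n] *)
pose S := fix S n := if n is n.+1 then step n (S n) else (A, B).
have mS n : measurable (S n).1 /\ measurable (S n).2.
  elim: n => //= n [m1 m2]; have mP : measurable (P n (S n)).
    by apply: measurableI => //; exact: measurable_preimage.
  split; apply: measurableD => //; exact: measurable_preimage.
have mP n : measurable (P n (S n)).
  by have [m1 m2] := mS n; apply: measurableI => //; exact: measurable_preimage.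
pose Q n := kappa' n @^-1` P n (S n).
have mQ n : measurable (Q n) by exact: measurable_preimage.
have S1A n : (S n).1 `<=` A by elim: n => //= n IH x [/IH].
have S2B n : (S n).2 `<=` B by elim: n => //= n IH x [/IH].
have dec m n : (m < n)%N ->
    (S n).1 `<=` ~` P m (S m) /\ (S n).2 `<=` ~` Q m.
  elim: n => // n IH; rewrite ltnS leq_eqVlt => /orP[/eqP ->|/IH[h1 h2]].
    by split=> x [].
  by split=> x [/= xn _]; [exact: h1|exact: h2].
have PA n x : P n (S n) x -> A x by move=> [/S1A].
have QB n x : Q n x -> B x by rewrite /Q /= => -[_ /=]; rewrite kK' => /S2B.
have PQ n x : P n (S n) x -> Q n (kappa n x) by rewrite /Q /= kK.
have QS n x : Q n x -> (S n).2 x by rewrite /Q /= => -[_ /=]; rewrite kK'.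
have Puniq m n x : P m (S m) x -> P n (S n) x -> m = n.
  by move=> Pm Pn; case: (ltngtP m n) => // /dec[h _];
    [have := h _ Pn.1|have := h _ Pm.1].
have Quniq m n x : Q m x -> Q n x -> m = n.
  move=> Qm Qn; case: (ltngtP m n) => // /dec[_ h];
    [by have := h _ (QS _ _ Qn)|by have := h _ (QS _ _ Qm)].
pose UP := \bigcup_n P n (S n); pose UQ := \bigcup_n Q n.
have mUP : measurable UP by exact: bigcup_measurable.
have mUQ : measurable UQ by exact: bigcup_measurable.
have [phi hphi] : {phi : T -> T & forall x,
    [/\ forall n, P n (S n) x -> phi x = kappa n x,
        forall n, Q n x -> phi x = kappa' n x &
        ~ UP x -> ~ UQ x -> phi x = x]}.
  apply: (@choice _ _ (fun x y => [/\ forall n, P n (S n) x -> y = kappa n x,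
        forall n, Q n x -> y = kappa' n x & ~ UP x -> ~ UQ x -> y = x])) => x.
  have [[n _ Px]|nP] := EM (UP x).
    exists (kappa n x); split=> [m Pm|m Qm|[]]; last by exists n.
      by rewrite (Puniq _ _ _ Px Pm).
    by have := disj _ (PA _ _ Px) (QB _ _ Qm).
  have [[n _ Qx]|nQ] := EM (UQ x).
    exists (kappa' n x); split=> [m Pm|m Qm|_ []]; last by exists n.
      by have := disj _ (PA _ _ Pm) (QB _ _ Qx).
    by rewrite (Quniq _ _ _ Qx Qm).
  by exists x; split=> // n h; exfalso; [apply: nP|apply: nQ]; exists n.
have phiP n x : P n (S n) x -> phi x = kappa n x by have [+ _ _] := hphi x; apply.
have phiQ n x : Q n x -> phi x = kappa' n x by have [_ + _] := hphi x; apply.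
have phi0 x : ~ UP x -> ~ UQ x -> phi x = x by have [_ _] := hphi x.
have invol : involutive phi.
  move=> x; have [[n _ Px]|nP] := EM (UP x).
    by rewrite (phiP _ _ Px) (phiQ n) ?kK //; exact: PQ.
  have [[n _ Qx]|nQ] := EM (UQ x).
    by rewrite (phiQ _ _ Qx) (phiP n) ?kK'.
  by rewrite !phi0 // phi0.
have phiF x : F x (phi x).
  have [[n _ Px]|nP] := EM (UP x); first by rewrite (phiP _ _ Px); exact: kappa_in.
  have [[n _ Qx]|nQ] := EM (UQ x).
    by rewrite (phiQ _ _ Qx); apply: F_sym; rewrite -{2}(kK' n x); exact: kappa_in.
  by rewrite phi0 //; exact: F_refl.
have mphi : measurable_fun setT phi.
  move=> _ C mC; rewrite setTI.
  have -> : phi @^-1` C = (\bigcup_n (P n (S n) `&` kappa n @^-1` C)) `|`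
      (\bigcup_n (Q n `&` kappa' n @^-1` C)) `|` (~` UP `&` ~` UQ `&` C).
    apply/seteqP; split=> x /=.
      move=> Cx; have [[n _ Px]|nP] := EM (UP x).
        by left; left; exists n => //; split=> //=; rewrite -(phiP n).
      have [[n _ Qx]|nQ] := EM (UQ x).
        by left; right; exists n => //; split=> //=; rewrite -(phiQ n).
      by right; split=> //; rewrite -(phi0 x).
    move=> [[[n _ [Px Cx]]|[n _ [Qx Cx]]]|[[nP nQ] Cx]].
    - by rewrite (phiP _ _ Px).
    - by rewrite (phiQ _ _ Qx).
    - by rewrite phi0.
  apply: measurableU; first apply: measurableU.
  - by apply: bigcup_measurable => n _; apply: measurableI => //;
      exact: measurable_preimage.
  - by apply: bigcup_measurable => n _; apply: measurableI => //;
      exact: measurable_preimage.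
  - by apply: measurableI => //; apply: measurableI; exact: measurableC.
pose A' := A `\` UP; pose B' := B `\` UQ.
have mA' : measurable A' by exact: measurableD.
have mB' : measurable B' by exact: measurableD.
have A'S n : A' `<=` (S n).1.
  by move=> x [Ax nx]; elim: n => //= n IH; split=> // Px; apply: nx; exists n.
have B'S n : B' `<=` (S n).2.
  by move=> x [Bx nx]; elim: n => //= n IH; split=> // Px; apply: nx; exists n.
have prUPQ : pr mu UP = pr mu UQ.
  rewrite -(presF (involution_automorphism invol mphi) phiF mUP).
  congr (pr mu _); apply/seteqP; split=> x /=.
    move=> [n _ Px]; exists n => //; rewrite -(invol x) (phiP _ _ Px); exact: PQ.
  by move=> [n _ Qx]; exists n => //; rewrite (phiQ _ _ Qx).
have UPA : A `&` UP = UP.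
  by apply/seteqP; split=> x [] // n _ Px; split; [exact: PA Px|exists n].
have UQB : B `&` UQ = UQ.
  by apply/seteqP; split=> x [] // n _ Qx; split; [exact: QB Qx|exists n].
have prA'B' : pr mu A' = pr mu B'.
  have := prDI mu mA mUP; have := prDI mu mB mUQ; rewrite UPA UQB /A' /B'; lra.
have unrelated x y : A' x -> B' y -> F x y -> False.
  move=> A'x B'y /kappaF[n nxy]; apply: (dec n n.+1 (leqnn _)).1 (A'S n.+1 _ A'x) _.
  by split; [exact: A'S|rewrite /= nxy; exact: B'S].
have A'0 : pr mu A' = 0.
  have [|] := ergodicF (measurable_saturation mA') (@saturation_invariant A').
    by apply: pr_null_sub => //; [exact: measurable_saturation|exact: sub_saturation].
  rewrite prA'B'; apply: pr_null_sub => //.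
    exact/measurableC/measurable_saturation.
  move=> y B'y [n _ A'y]; apply: (unrelated _ _ A'y B'y).
  by apply: F_sym; exact: kappa_in.
exists phi, (saturation A' `|` saturation B'); split=> //.
  by apply: null_invariantU; apply: saturation_null => //; rewrite -prA'B'.
split=> [x nN|x nA nB].
  split=> [Ax|Bx].
    have [[n _ Px]|nP] := EM (UP x).
      by rewrite (phiP _ _ Px); apply: QB; exact: PQ Px.
    by exfalso; apply: nN; left; apply: sub_saturation.
  have [[n _ Qx]|nQ] := EM (UQ (phi x)).
    by rewrite -(invol x) (phiQ _ _ Qx); exact: PA Qx.
  exfalso; apply: nN; right; apply: (@saturation_invariant B' (phi x)).
    by apply: F_sym.
  exact: sub_saturation.
by apply: phi0 => -[n _ h]; [apply: nA; exact: PA h|apply: nB; exact: QB h].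
Qed.

Hypothesis points0 : forall x, pr mu [set x] = 0.
Variable U : nat -> set T.
Hypothesis baseU : standard_base U.

(** Having finitely many values along a translate of the natural numbers makes
    a median the least value with a certain property. *)
Definition lattice_valued (G : T -> R) : Prop :=
  exists (c : R) (M : nat), forall x, exists2 k, (k <= M)%N & G x = k%:R - c.

(** The set [C] is cut at a median of [G]; as there are no atoms, the points
    where [G] takes the median value can be divided so that both halves have the
    same measure and can be matched. *)
Lemma median_matching (C : set T) (G : T -> R) : measurable C -> measurable_fun setT G ->
  lattice_valued G ->
  exists phi A N v, [/\ measurable_fun setT phi, involutive phi,
      forall x, F x (phi x), null_invariant N & measurable A] /\
    [/\ A `<=` C,
      forall x, ~ N x -> (A x <-> C (phi x) /\ ~ A (phi x)),
      forall x, ~ C x -> phi x = x,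
      forall x, A x -> G x <= v &
      forall x, C x -> ~ A x -> v <= G x].
Proof.
move=> mC mG [c [M GM]]; pose t := pr mu C / 2.
have prC0 := pr_ge0 mu C.
pose L (k : nat) := C `&` [set x | G x <= k%:R - c].
have mL k : measurable (L k).
  apply: measurableI => //; rewrite -[X in measurable X]setTI.
  by apply: measurable_fun_le => //; exact: measurable_cst.
have exk : exists k, t <= pr mu (L k).
  exists M; rewrite (_ : L M = C); first by rewrite /t; lra.
  rewrite /L setIidl // => x Cx /=; have [k kM ->] := GM x.
  by rewrite lerD2r ler_nat.
case: (ex_minnP exk) => k tk mink.
pose v := k%:R - c.
pose D0 := C `&` [set x | G x < v].
have mD0 : measurable D0.
  rewrite (_ : D0 = C `\` [set x | v <= G x]).
    apply: measurableD => //; rewrite -[X in measurable X]setTI.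
    by apply: measurable_fun_le => //; exact: measurable_cst.
  by apply/seteqP; split=> x [Cx /= h]; split=> //=; [apply/negP; rewrite -ltNge|
    rewrite ltNge; apply/negP].
have D0t : pr mu D0 <= t.
  have [k0|k0] := posnP k.
    rewrite (_ : D0 = set0); first by rewrite pr0 /t; lra.
    apply/seteqP; split=> // x [_]; rewrite /= /v k0; have [j _ ->] := GM x.
    by rewrite ltrD2r ltr_nat.
  apply: (@le_trans _ _ (pr mu (L k.-1))).
    apply: le_pr => // x [Cx]; rewrite /= /v; have [j _ ej] := GM x.
    rewrite ej ltrD2r ltr_nat => jk; split=> //=.
    by rewrite ej lerD2r ler_nat -ltnS prednK.
  rewrite leNgt; apply/negP => /ltW /mink; rewrite leqNgt prednK // leqnn //.
pose D1 := L k `\` D0.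
have mD1 : measurable D1 by exact: measurableD.
have D0L : D0 `<=` L k by move=> x [Cx /= /ltW].
have prD1 : pr mu (L k) = pr mu D1 + pr mu D0.
  by rewrite (prDI mu (mL k) mD0) (setIidr D0L).
have [|D' [mD' D'D1 prD']] := subset_of_measure baseU (t := t - pr mu D0) points0 mD1.
  by apply/andP; split; lra.
pose A := D0 `|` D'.
have mA : measurable A by exact: measurableU.
have AC : A `<=` C by move=> x [[]//|/D'D1[[]]].
have prA : pr mu A = t.
  rewrite prU // ?prD'; first by lra.
  by apply/seteqP; split=> x // [Dx /D'D1[]].
have mB : measurable (C `\` A) by exact: measurableD.
have prB : pr mu A = pr mu (C `\` A).
  have := prDI mu mC mA; rewrite (setIidr AC) prA /t; lra.
have [|phi [N [mphi invol phiF nN [swap fixed]]]] := matching mA mB _ prB.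
  by apply/seteqP; split=> x // [Ax []].
exists phi, A, N, v; split=> //; split=> //.
- move=> x nC; apply: fixed => [/AC //|[]//].
- by move=> x [[_ /= /ltW]|/D'D1[[_ ]]].
- move=> x Cx nA; rewrite leNgt; apply/negP => lt; apply: nA; left; split=> //.
Qed.

End FullGroup.

(** * Odometers as infinite compositions of matchings *)

Section OdometerMap.
Variables (T : Type) (C : nat -> set T) (phi : nat -> T -> T).
Hypothesis C0 : C 0%N = setT.
Hypothesis Cdec : forall n, C n.+1 `<=` C n.
Hypothesis phiK : forall n, involutive (phi n).
Hypothesis phi_fixed : forall n x, ~ C n x -> phi n x = x.

(** [run n m] is [phi (n + m - 1) \o ... \o phi n]. *)
Fixpoint run n m x : T := if m is m.+1 then phi (n + m)%N (run n m x) else x.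

Fixpoint unrun n x : T := if n is n.+1 then unrun n (phi n x) else x.

Lemma runS n m x : run n m.+1 x = run n.+1 m (phi n x).
Proof. by elim: m => /= [|m <-]; rewrite ?addn0 // addSnnS. Qed.

Lemma runK n : cancel (run 0 n) (unrun n).
Proof. by elim: n => //= n IH x; rewrite add0n phiK. Qed.

Lemma unrunK n : cancel (unrun n) (run 0 n).
Proof. by elim: n => //= n IH x; rewrite add0n IH phiK. Qed.

Lemma run_stable n m k x :
  ~ C (n + m)%N (run n m x) -> run n (m + k)%N x = run n m x.
Proof.
move=> nC; suff [] : run n (m + k)%N x = run n m x /\
  ~ C (n + (m + k))%N (run n m x) by [].
elim: k => [|k [IH nCk]]; first by rewrite addn0.
by rewrite addnS /= IH phi_fixed // addnS; split=> // /Cdec.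
Qed.

Lemma unrun_stable n k x : ~ C n x -> unrun (n + k)%N x = unrun n x.
Proof.
move=> nC; suff [] : unrun (n + k)%N x = unrun n x /\ ~ C (n + k)%N x by [].
elim: k => [|k [IH nCk]]; first by rewrite addn0.
by rewrite addnS /= phi_fixed //; split=> // /Cdec.
Qed.

(** Once the composition of the first matchings has left the current base, it
    also lies outside all later bases and all later matchings fix it. So the
    infinite composition [... \o phi n.+1 \o phi n] makes sense there. *)
Lemma exists_odometer : exists od : nat -> T -> T, forall n m x,
  ~ C (n + m)%N (run n m x) -> od n x = run n m x.
Proof.
suff h n x : exists y, forall m, ~ C (n + m)%N (run n m x) -> y = run n m x.
  have h2 n : exists f : T -> T, forall x m,
      ~ C (n + m)%N (run n m x) -> f x = run n m x.
    by have [f hf] := choice (h n); exists f.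
  by have [od hod] := choice h2; exists od => n m x; exact: hod.
have [[m nC]|no] := EM (exists m, ~ C (n + m)%N (run n m x)).
  exists (run n m x) => m' nC'; case: (leqP m m') => mm'.
    by rewrite -(subnKC mm') run_stable.
  by rewrite -(subnKC (ltnW mm')) run_stable.
by exists x => m nC; case: no; exists m.
Qed.

Lemma exists_odometer_inverse : exists od' : T -> T, forall n x,
  ~ C n x -> od' x = unrun n x.
Proof.
suff h x : exists y, forall n, ~ C n x -> y = unrun n x.
  by have [od' hod] := choice h; exists od' => n x; exact: hod.
have [[m nC]|no] := EM (exists m, ~ C m x).
  exists (unrun m x) => m' nC'; case: (leqP m m') => mm'.
    by rewrite -(subnKC mm') unrun_stable.
  by rewrite -(subnKC (ltnW mm')) unrun_stable.
by exists x => m nC; case: no; exists m.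
Qed.

Variable od : nat -> T -> T.
Hypothesis odE : forall n m x, ~ C (n + m)%N (run n m x) -> od n x = run n m x.
Variable Y : set T.
Hypothesis Yphi : forall n x, Y x -> Y (phi n x).
Hypothesis Yswap : forall n x, Y x ->
  (C n.+1 x <-> C n (phi n x) /\ ~ C n.+1 (phi n x)).
Hypothesis Yrun : forall n x, Y x -> exists m, ~ C (n + m)%N (run n m x).

Lemma od_out n x : ~ C n x -> od n x = x.
Proof. by move=> nC; rewrite (@odE n 0%N) //= addn0. Qed.

Lemma od_step n x : Y x -> od n x = od n.+1 (phi n x).
Proof.
move=> Yx; have [m nC] := Yrun n.+1 (Yphi n Yx).
by rewrite (odE nC) -runS; apply: odE; rewrite addnS -addSn runS.
Qed.

Lemma od_base n x : Y x -> C n.+1 x -> od n x = phi n x.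
Proof. by move=> Yx /(Yswap n Yx) [_ h]; rewrite od_step // od_out. Qed.

Lemma od_double n x : Y x -> C n.+1 x -> od n (od n x) = od n.+1 x.
Proof.
by move=> Yx Cx; rewrite (od_base Yx Cx) od_step ?phiK //; exact: Yphi.
Qed.

(** Squaring passes to the shifted sequence, by [od_double]. *)
Lemma od_pow n x : Y x -> C n x -> iter (2 ^ n) (od 0) x = od n x.
Proof.
elim: n x => [//|n IH] x Yx Cx.
rewrite expnS mul2n -addnn iterD (IH x Yx (Cdec Cx)) -od_double //.
by rewrite (od_base Yx Cx) IH //; [exact: Yphi|have [] := (Yswap n Yx).1 Cx].
Qed.

Lemma od_pow_base n x : Y x -> C n.+1 x -> iter (2 ^ n) (od 0) x = phi n x.
Proof. by move=> Yx Cx; rewrite od_pow ?od_base //; exact: Cdec Cx. Qed.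

Lemma od_no_return n x i : Y x -> C n x -> (0 < i < 2 ^ n)%N ->
  ~ C n (iter i (od 0) x).
Proof.
elim: n x i => [|n IH] x i Yx Cx.
  by rewrite expn0; case: i => [|[]].
rewrite expnS mul2n -addnn => /andP[i0 i2].
have Cnx : C n x := Cdec Cx.
case: (ltngtP i (2 ^ n)) => [lt|gt|->].
- by move=> /Cdec; apply: IH => //; rewrite i0.
- rewrite -(subnK (ltnW gt)) iterD od_pow_base // => /Cdec; apply: IH.
  + exact: Yphi.
  + by have [] := (Yswap n Yx).1 Cx.
  + by move: gt i2; lia.
- by rewrite od_pow_base //; have [] := (Yswap n Yx).1 Cx.
Qed.

Lemma od_Y x : Y x -> Y (od 0 x).
Proof.
move=> Yx; have [m nC] := Yrun 0%N Yx; rewrite (odE nC).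
by elim: m {nC} => //= m; exact: Yphi.
Qed.

Lemma od_iter_Y i x : Y x -> Y (iter i (od 0) x).
Proof. by move=> Yx; elim: i => //= i; exact: od_Y. Qed.

Lemma phi_C n k x : C n x -> C n (phi (n + k)%N x).
Proof.
move=> Cx; have [Cnk|] := EM (C (n + k)%N x); last by move/phi_fixed ->.
have sub j : C (n + j)%N `<=` C n.
  by elim: j => [|j IH]; rewrite ?addn0 ?addnS //; exact: subset_trans (Cdec (n := _)) IH.
apply: (sub k); apply: contrapT => nC; apply: (nC).
by rewrite -(phi_fixed nC) phiK.
Qed.

Lemma od_C n x : Y x -> C n x -> C n (od n x).
Proof.
move=> Yx Cx; have [m nC] := Yrun n Yx; rewrite (odE nC).
by elim: m {nC} => //= m IH; exact: phi_C.
Qed.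

Lemma od_hits n x : Y x -> exists i, C n (iter i (od 0) x).
Proof.
move=> Yx; elim: n => [|n [i Ci]]; first by exists 0%N; rewrite C0.
set y := iter i _ x in Ci; have Yy : Y y by exact: od_iter_Y.
have [Cy|nCy] := EM (C n.+1 y); first by exists i.
exists (2 ^ n + i)%N; rewrite iterD -/y od_pow // od_step //.
apply: od_C; first exact: Yphi.
by apply/(Yswap n (Yphi n Yy)); rewrite phiK.
Qed.

(** Every orbit meets every base, and a point of [C n] does not return to
    [C n] before time [2 ^ n]. *)
Lemma od_aperiodic x m : Y x -> (0 < m)%N -> iter m (od 0) x <> x.
Proof.
move=> Yx m0 per; have [i Ci] := od_hits m Yx.
apply: (od_no_return (od_iter_Y i Yx) Ci (i := m)).
  by rewrite m0 ltn_expl.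
by rewrite -iterD addnC iterD per.
Qed.

Lemma od_invariant (D : set T) n x : (forall x, Y x -> (D x <-> D (od 0 x))) ->
  Y x -> (D x <-> D (phi n x)).
Proof.
move=> invD Yx.
have inv i y : Y y -> (D y <-> D (iter i (od 0) y)).
  move=> Yy; elim: i => //= i IH; rewrite IH; apply: invD; exact: od_iter_Y.
have [Cx|nCx] := EM (C n.+1 x).
  by rewrite -od_pow_base //; exact: inv.
have [Cx|] := EM (C n x); last by move/phi_fixed ->.
have Yp := Yphi n Yx.
rewrite -{1}(phiK n x) -od_pow_base //; first by rewrite -inv.
by apply/(Yswap n Yp); rewrite phiK.
Qed.

Lemma od_inverse (od' : T -> T) :
  (forall n x, ~ C n x -> od' x = unrun n x) ->
  (forall x, Y x -> exists n, ~ C n x) ->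
  forall x, Y x -> [/\ Y (od' x), od' (od 0 x) = x & od 0 (od' x) = x].
Proof.
move=> od'E Yout x Yx; have [n nC] := Yout x Yx; split.
- rewrite (od'E n x nC); elim: n x {nC} Yx => //= n IH x Yx.
  by apply: IH; exact: Yphi.
- by have [m nCm] := Yrun 0%N Yx; rewrite (odE nCm) (od'E _ _ nCm) runK.
- by rewrite (od'E n x nC) (@odE 0%N n) ?unrunK.
Qed.

End OdometerMap.

(** * An ergodic odometer *)

Lemma half_pow_lt (R : realType) (e : R) :
  (0 < e)%R -> exists k, (2^-1 ^+ k < e)%R.
Proof.
move=> e0; have h : (`|2^-1 : R| < 1)%R by rewrite ger0_norm; lra.
by have /cvgr_lt /(_ e e0) [k _ /(_ k (leqnn k)) hk] := cvg_expr h; exists k.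
Qed.

Section ErgodicOdometer.
Local Open Scope ring_scope.
Context d (T : measurableType d) (R : realType) (mu : probability T R).
Variables (F : T -> T -> Prop) (kappa : nat -> T -> T).
Hypothesis equivF : Equivalence F.
Hypothesis kappa_aut : forall n, automorphism (kappa n).
Hypothesis kappaF : forall x y, F x y <-> exists n, kappa n x = y.
Hypothesis presF : forall f, automorphism f -> (forall x, F x (f x)) ->
  forall A, measurable A -> pr mu (f @^-1` A) = pr mu A.
Hypothesis ergodicF : forall A, measurable A ->
  (forall x y, F x y -> A x -> A y) -> pr mu A = 0 \/ pr mu (~` A) = 0.
Hypothesis points0 : forall x, pr mu [set x] = 0.
Variable U : nat -> set T.
Hypothesis baseU : standard_base U.

Notation Emu := (mean mu).
Let B j := dnf U (odflt [::] (unpickle j)).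

Let mB j : measurable (B j). Proof. exact: measurable_dnf. Qed.

(** The 2-adic valuation takes every value infinitely often. *)
Let selected n := logn 2 n.

Lemma selected_late j n0 : exists2 n, (n0 <= n)%N & selected n = j.
Proof.
exists (2 ^ j * (2 * n0).+1)%N; first by have := expn_gt0 2 j; nia.
rewrite /selected lognM ?expn_gt0 // pfactorK // logn_coprime ?addn0 //.
by rewrite coprime2n /= mul2n odd_double.
Qed.

Lemma lattice_valued_bounded (G : T -> R) : measurable_fun setT G ->
  lattice_valued G -> bounded_measurable G.
Proof.
move=> mG [c [M GM]]; split=> //; exists (M%:R + `|c|) => x.
have [k kM ->] := GM x; rewrite (le_trans (ler_normB _ _)) // lerD2r.
by rewrite normr_nat ler_nat.
Qed.

(** After [n] steps a point of the base and the points that have been matched to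
    it, directly or indirectly, form a block of [2 ^ n] points, and [sums j] is
    the sum of [\1_(B j) - pr mu (B j)] over this block. *)
Record stage : Type := Stage {
  base : set T;
  sums : nat -> T -> R;
  measurable_base : measurable base;
  measurable_sums : forall j, measurable_fun setT (sums j);
  lattice_sums : forall j, lattice_valued (sums j) }.

Lemma stage0 : {s : stage | base s = setT /\
  sums s = fun j x => \1_(B j) x - pr mu (B j)}.
Proof.
have ms j : measurable_fun setT (fun x => \1_(B j) x - pr mu (B j) : R).
  by apply: measurable_funB => //; exact: measurable_indic.
have ls j : lattice_valued (fun x => \1_(B j) x - pr mu (B j) : R).
  exists (pr mu (B j)), 1%N => x; exists (x \in B j : nat); last by rewrite indicE.
  by case: (_ \in _).
by exists (Stage measurableT ms ls).
Qed.

Definition next_stage n (s s' : stage) (phi : T -> T) (N : set T) : Prop :=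
  [/\ measurable_fun setT phi, involutive phi,
      forall x, F x (phi x), null_invariant mu F N & base s' `<=` base s] /\
  [/\ forall x, ~ N x -> (base s' x <-> base s (phi x) /\ ~ base s' (phi x)),
      forall x, ~ base s x -> phi x = x,
      sums s' = fun j x => sums s j x + sums s j (phi x) &
      exists v, (forall x, base s' x -> sums s (selected n) x <= v) /\
        (forall x, base s x -> ~ base s' x -> v <= sums s (selected n) x)].

Lemma exists_next n s : exists s' phi N, next_stage n s s' phi N.
Proof.
have [phi [A [N [v [[mphi invol phiF nN mA] [AC swap fixed lo hi]]]]]] :=
  median_matching equivF kappa_aut kappaF presF ergodicF points0 baseU
    (measurable_base s) (measurable_sums s (selected n))
    (lattice_sums s (selected n)).
have ms j : measurable_fun setT (fun x => sums s j x + sums s j (phi x)).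
  apply: measurable_funD; first exact: measurable_sums.
  by apply: measurableT_comp => //; exact: measurable_sums.
have ls j : lattice_valued (fun x => sums s j x + sums s j (phi x)).
  have [c [M h]] := lattice_sums s j; exists (c + c), (M + M)%N => x.
  have [k kM ->] := h x; have [k' k'M ->] := h (phi x).
  by exists (k + k')%N; [exact: leq_add|rewrite natrD; ring].
exists (Stage mA ms ls), phi, N; split=> //=; split=> //.
by exists v.
Qed.

Lemma exists_stages : exists (s : nat -> stage) phi N,
  [/\ base (s 0%N) = setT,
      sums (s 0%N) = (fun j x => \1_(B j) x - pr mu (B j)) &
      forall n, next_stage n (s n) (s n.+1) (phi n) (N n)].
Proof.
pose P n s (o : stage * (T -> T) * set T) := next_stage n s o.1.1 o.1.2 o.2.
have ex n s : exists o, P n s o.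
  by have [s' [phi [N h]]] := exists_next n s; exists (s', phi, N).
have [f hf] : {f : nat * stage -> stage * (T -> T) * set T &
    forall p, P p.1 p.2 (f p)}.
  by apply: (@choice _ _ (fun p o => P p.1 p.2 o)) => p; exact: ex.
have [s0 [b0 g0]] := stage0.
pose s := fix s n := if n is n.+1 then (f (n, s n)).1.1 else s0.
exists s, (fun n => (f (n, s n)).1.2), (fun n => (f (n, s n)).2).
by split=> // n; exact: (hf (n, s n)).
Qed.

Section Stages.
Variables (s : nat -> stage) (phi : nat -> T -> T) (N : nat -> set T).
Hypothesis base0 : base (s 0%N) = setT.
Hypothesis sums0 : sums (s 0%N) = (fun j x => \1_(B j) x - pr mu (B j)).
Hypothesis nextS : forall n, next_stage n (s n) (s n.+1) (phi n) (N n).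

Let C n := base (s n).
Let G n j := sums (s n) j.

Let mC n : measurable (C n). Proof. exact: measurable_base. Qed.

Lemma stages_automorphism n : automorphism (phi n).
Proof. by have [[m i _ _ _] _] := nextS n; exact: involution_automorphism. Qed.

Lemma stages_in n x : F x (phi n x).
Proof. by have [[_ _ h _ _] _] := nextS n. Qed.

Let mphi n : measurable_fun setT (phi n).
Proof. by have [[]] := nextS n. Qed.

Let bG n j : bounded_measurable (G n j).
Proof.
by apply: lattice_valued_bounded; [exact: measurable_sums|exact: lattice_sums].
Qed.

Let bC n : bounded_measurable (\1_(C n) : T -> R).
Proof. exact: bounded_measurable_indic. Qed.

(** Up to a null set, the base is the disjoint union of the next base and its
    mirror image. *)
Lemma mean_fold n h : bounded_measurable h ->
  Emu (fun x => \1_(C n) x * h x) =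
  Emu (fun x => \1_(C n.+1) x * (h x + h (phi n x))).
Proof.
move=> bh; have [[_ invol inF [mN N0 iN] sub] [swap fixed _ _]] := nextS n.
have bhp := bounded_measurable_comp (mphi n) bh.
have bCp := bounded_measurable_comp (mphi n) (bC n.+1).
have -> : Emu (fun x => \1_(C n) x * h x) =
    Emu (fun x => \1_(C n.+1) x * h x + \1_(C n.+1) (phi n x) * h x).
  apply: (mean_eq_mod0 mN N0).
  - exact: bounded_measurableM.
  - by apply: bounded_measurableD; exact: bounded_measurableM.
  move=> x Nx; rewrite -mulrDl; congr (_ * _); rewrite !indicE -natrD; congr _%:R.
  have swap' : C n.+1 (phi n x) <-> C n x /\ ~ C n.+1 x.
    have := swap (phi n x); rewrite invol; apply=> Nphi; apply: Nx.
    by apply: iN Nphi; exact: (F_sym equivF).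
  have [Cx|nCx] := EM (C n x); last first.
    have nC1 : ~ C n.+1 x by move=> /sub.
    by rewrite !memNset // => /swap' [].
  have [C1x|nC1x] := EM (C n.+1 x).
    by rewrite (mem_set Cx) (mem_set C1x) memNset // => /swap' [].
  by rewrite (mem_set Cx) (memNset nC1x) mem_set //; exact/swap'.
rewrite meanD; last 2 first.
- exact: bounded_measurableM.
- exact: bounded_measurableM.
have -> : Emu (fun x => \1_(C n.+1) (phi n x) * h x) =
    Emu (fun x => \1_(C n.+1) x * h (phi n x)).
  rewrite -(@mean_comp _ _ _ mu (fun x => \1_(C n.+1) x * h (phi n x)) (phi n)) //.
  - by congr Emu; apply/funext => x; rewrite invol.
  - by apply: presF; [exact: stages_automorphism|exact: stages_in].
  - exact: bounded_measurableM.
rewrite -meanD; last 2 first.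
- exact: bounded_measurableM.
- exact: bounded_measurableM.
by congr Emu; apply/funext => x; rewrite mulrDr.
Qed.

Lemma sumsS n j x : G n.+1 j x = G n j x + G n j (phi n x).
Proof. by have [_ [_ _ e _]] := nextS n; rewrite /G e. Qed.

Lemma pr_base n : pr mu (C n) = 2^-1 ^+ n.
Proof.
have e m : Emu (fun x => \1_(C m) x * 1) = pr mu (C m).
  by rewrite -(mean_indic mu (mC m)); congr Emu; apply/funext => x; rewrite mulr1.
elim: n => [|n IH]; first by rewrite /C base0 prT expr0.
have := mean_fold n (@bounded_measurable_cst _ T R 1); rewrite e IH.
have -> : Emu (fun x => \1_(C n.+1) x * (1 + 1)) = 2 * pr mu (C n.+1).
  rewrite -(mean_indic mu (mC n.+1)) -meanZ //; congr Emu; apply/funext => x.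
  by rewrite mulrC.
by rewrite exprS => h; lra.
Qed.

Lemma mean_sums n j : Emu (fun x => \1_(C n) x * G n j x) = 0.
Proof.
elim: n => [|n IH].
  have -> : Emu (fun x => \1_(C 0%N) x * G 0 j x) =
      Emu (fun x => \1_(B j) x + - pr mu (B j)).
    congr Emu; apply/funext => x.
    by rewrite /C /G base0 sums0 indicT mul1r.
  rewrite meanD; [|exact: bounded_measurable_indic|exact: bounded_measurable_cst].
  rewrite mean_indic // /mean Rintegral_cst // -/(pr mu setT) prT; ring.
rewrite -[RHS]IH [RHS]mean_fold //; congr Emu; apply/funext => x.
by rewrite sumsS.
Qed.

(** Up to the factor [2 ^ n], this is the variance of the average of [B j] over
    the blocks. *)
Definition variance n j := Emu (fun x => \1_(C n) x * (G n j x * G n j x)).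

Lemma variance_ge0 n j : 0 <= variance n j.
Proof.
apply: Rintegral_ge0 => x _; rewrite indicE; apply: mulr_ge0; first exact: ler0n.
by rewrite -expr2 sqr_ge0.
Qed.

Lemma varianceS n j : variance n.+1 j <= 2 * variance n j.
Proof.
have b2 := bounded_measurableM (bG n j) (bG n j).
have b2p := bounded_measurable_comp (mphi n) b2.
rewrite /variance [X in _ <= 2 * X]mean_fold // -meanZ; last first.
  by apply: bounded_measurableM => //; exact: bounded_measurableD.
apply: le_mean.
- by apply: bounded_measurableM => //; exact: bounded_measurableM.
- apply: bounded_measurableM; first exact: bounded_measurable_cst.
  by apply: bounded_measurableM => //; exact: bounded_measurableD.
move=> x; rewrite sumsS indicE; case: (_ \in _); last by rewrite !mul0r mulr0.
rewrite !mul1r; have := sqr_ge0 (G n j x - G n j (phi n x)).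
by rewrite expr2; nra.
Qed.

(** The two sums that are added lie on different sides of the median [v], and
    [(a - v) * (b - v) <= 0] bounds the mixed term [a * b] of [(a + b) ^ 2] by
    [v * (a + b) - v ^ 2]. The mean of [a + b] vanishes. *)
Lemma variance_selected n : variance n.+1 (selected n) <= variance n (selected n).
Proof.
set j := selected n; have [[_ invol _ nN sub] [swap fixed _ [v [lo hi]]]] := nextS n.
have [mN N0 iN] := nN.
have b2 := bounded_measurableM (bG n j) (bG n j).
have bGp := bounded_measurable_comp (mphi n) (bG n j).
have b2p := bounded_measurable_comp (mphi n) b2.
have bS := bounded_measurableD (bG n j) bGp.
have bcst c := @bounded_measurable_cst _ T R c.
have bI : bounded_measurable (\1_(N n) : T -> R) by exact: bounded_measurable_indic.
have bCS := bounded_measurableM (bC n.+1) bS.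
have bC2 := bounded_measurableM (bC n.+1) (bounded_measurableD b2 b2p).
have bvS := bounded_measurableM (bcst (2 * v)) bCS.
have bvv := bounded_measurableM (bcst (- (2 * v ^+ 2))) (bC n.+1).
have bG1 := bounded_measurableM (bC n.+1) (bounded_measurableM (bG n.+1 j) (bG n.+1 j)).
have Svar : Emu (fun x => \1_(C n.+1) x *
    (G n j x * G n j x + G n j (phi n x) * G n j (phi n x))) = variance n j.
  by rewrite /variance [RHS]mean_fold.
have S0 : Emu (fun x => \1_(C n.+1) x * (G n j x + G n j (phi n x))) = 0.
  by rewrite -(mean_sums n.+1 j); congr Emu; apply/funext => x; rewrite sumsS.
suff le : variance n.+1 j <= variance n j + (2 * v) * 0 +
    (- (2 * v ^+ 2)) * pr mu (C n.+1).
  have := pr_ge0 mu (C n.+1); have := sqr_ge0 v; nra.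
rewrite -Svar -[X in _ + _ * X + _]S0 -(mean_indic mu (mC n.+1)) -!meanZ // -!meanD //.
  apply: (le_mean_mod0 mN N0) => //.
    by apply: bounded_measurableD => //; exact: bounded_measurableD.
  move=> x Nx; rewrite sumsS indicE; have [C1|nC1] := EM (C n.+1 x); last first.
    by rewrite memNset // !(mul0r, mulr0) !addr0.
  rewrite mem_set // !(mul1r, mulr1).
  have [Cp nC1p] := (swap x Nx).1 C1.
  have := lo x C1; have := hi (phi n x) Cp nC1p; rewrite -/(G n j) expr2; nra.
exact: bounded_measurableD.
Qed.

(** Relative to [2 ^ n] the variance never increases, and it is halved whenever
    the index is selected. *)
Lemma variance_small j e : 0 < e -> exists n, 2^-1 ^+ n * variance n j < e.
Proof.
move=> e0; pose W n := 2^-1 ^+ n * variance n j.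
have Wdec n : W n.+1 <= W n.
  rewrite /W exprS; have := varianceS n j.
  have : 0 <= (2^-1 : R) ^+ n by rewrite exprn_ge0 // invr_ge0.
  by nra.
have Wmono n m : W (n + m)%N <= W n.
  by elim: m => [|m IH]; rewrite ?addn0 // addnS (le_trans (Wdec _)).
have Wsel n : selected n = j -> W n.+1 <= 2^-1 * W n.
  move=> sj; rewrite /W exprS; have := variance_selected n; rewrite sj.
  have : 0 <= (2^-1 : R) ^+ n by rewrite exprn_ge0 // invr_ge0.
  by nra.
have Wsmall k : exists n, W n <= 2^-1 ^+ k * W 0%N.
  elim: k => [|k [n Wn]]; first by exists 0%N; rewrite expr0 mul1r.
  have [m nm sm] := selected_late j n; exists m.+1.
  rewrite (le_trans (Wsel m sm)) // exprS -mulrA ler_wpM2l ?invr_ge0 //.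
  by rewrite -(subnKC nm) (le_trans (Wmono _ _)).
have W0 : 0 <= W 0%N by rewrite /W expr0 mul1r; exact: variance_ge0.
have [|k hk] := @half_pow_lt R (e / (W 0%N + 1)).
  by rewrite divr_gt0 //; lra.
have [n hn] := Wsmall k; exists n; rewrite -/(W n) (le_lt_trans hn) //.
rewrite ltr_pdivlMr in hk; last by lra.
have : 0 <= (2^-1 : R) ^+ k by rewrite exprn_ge0 // invr_ge0.
by nra.
Qed.

(** The correlation of [D] with [B j] can be computed on each base, by
    invariance, and there it is controlled by the variance. *)
Lemma stages_independent (D Y : set T) j : measurable D ->
  measurable Y -> pr mu Y = 0 ->
  (forall n x, ~ Y x -> (D x <-> D (phi n x))) ->
  pr mu (D `&` B j) = pr mu D * pr mu (B j).
Proof.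
move=> mD mY Y0 invD.
have bD : bounded_measurable (\1_D : T -> R) by exact: bounded_measurable_indic.
have bB : bounded_measurable (\1_(B j) : T -> R) by exact: bounded_measurable_indic.
have bDG n := bounded_measurableM bD (bG n j).
pose c n := Emu (fun x => \1_(C n) x * (\1_D x * G n j x)).
have c0 : c 0%N = pr mu (D `&` B j) - pr mu D * pr mu (B j).
  rewrite /c -(mean_indic mu (measurableI _ _ mD (mB j))) -(mean_indic mu mD) mulrC.
  rewrite -mulNr -meanZ // -meanD //.
  - by congr Emu; apply/funext => x; rewrite /C /G base0 sums0 indicT mul1r indicI
      /=; ring.
  - by apply: bounded_measurable_indic; exact: measurableI.
  - by apply: bounded_measurableM => //; exact: bounded_measurable_cst.
have cS n : c n.+1 = c n.
  rewrite /c [RHS]mean_fold //.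
  have bGp := bounded_measurable_comp (mphi n) (bG n j).
  have bDp := bounded_measurable_comp (mphi n) bD.
  apply: (mean_eq_mod0 mY Y0).
  - by apply: bounded_measurableM.
  - by apply: bounded_measurableM => //; apply: bounded_measurableD => //;
      exact: bounded_measurableM.
  move=> x Yx; congr (_ * _); rewrite sumsS mulrDr; congr (_ + _ * _).
  rewrite !indicE; congr (nat_of_bool _)%:R.
  by apply/idP/idP; rewrite !inE; apply invD.
have cc n : c n = c 0%N by elim: n => // n <-; exact: cS.
suff : c 0%N = 0 by rewrite c0 => /eqP; rewrite subr_eq0 => /eqP.
have small e : 0 < e -> `|c 0%N| <= 2 * e.
  move=> e0; have [|n] := @variance_small j (e * e); first exact: mulr_gt0.
  set h := 2^-1 ^+ n => hV; have h0 : 0 < h by rewrite exprn_gt0 // invr_gt0.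
  have b2 := bounded_measurableM (bC n) (bounded_measurableM (bG n j) (bG n j)).
  (* [|z| <= e / h + (h / e) * z ^ 2] trades the mean of [|z|] for the variance *)
  pose g x := (h / e) * (\1_(C n) x * (G n j x * G n j x)) + (e / h) * \1_(C n) x.
  have bg : bounded_measurable g.
    by apply: bounded_measurableD; apply: bounded_measurableM => //;
      exact: bounded_measurable_cst.
  have bcD : bounded_measurable (fun x => \1_(C n) x * (\1_D x * G n j x)).
    exact: bounded_measurableM.
  have meang : Emu g <= 2 * e.
    rewrite meanD; [|by apply: bounded_measurableM => //;
      exact: bounded_measurable_cst..].
    rewrite !meanZ // mean_indic // -/(variance n j) pr_base -/h divfK ?gt_eqF //.
    suff : h / e * variance n j <= e by lra.
    by rewrite mulrAC ler_pdivrMr // ltW.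
  have absG x : `|\1_(C n) x * (\1_D x * G n j x)| <= g x.
    rewrite /g indicE; case: (_ \in _); last by rewrite !(mul0r, mulr0) addr0 normr0.
    rewrite !(mul1r, mulr1) normrM.
    apply: (@le_trans _ _ `|G n j x|).
      rewrite ler_piMl // indicE; case: (_ \in _); rewrite ?normr1 ?normr0 //.
    rewrite -(ger0_norm (sqr_ge0 (G n j x) : 0 <= G n j x * G n j x)) normrM.
    have : 0 <= `|G n j x| by exact: normr_ge0.
    move: `|G n j x| => t t0; have a0 : 0 < h / e by exact: divr_gt0.
    have [ti|it] := leP t (e / h); first by nra.
    have au : h / e * (e / h) = 1 by rewrite mulrA divfK ?divff // gt_eqF.
    have u0 : 0 < e / h by exact: divr_gt0.
    move: (h / e) (e / h) au it a0 u0 => a u au it a0 u0.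
    have : a * u * t <= a * t * t by rewrite -!mulrA ler_pM2l // ler_wpM2r // ltW.
    by rewrite au -mulrA; lra.
  rewrite -(cc n) ler_norml; apply/andP; split.
    rewrite -[c n]opprK lerN2 -mulN1r -meanZ // (le_trans _ meang) //.
    apply: le_mean => //.
      by apply: bounded_measurableM => //; exact: bounded_measurable_cst.
    by move=> x; have := absG x; rewrite ler_norml mulN1r => /andP[? _]; lra.
  rewrite (le_trans _ meang) //; apply: le_mean => // x.
  by have := absG x; rewrite ler_norml => /andP[].
apply/eqP; rewrite -normr_le0; apply/ler_addgt0Pr => e e0; rewrite add0r.
have e2 : 0 < e / 2 by lra.
by have := small _ e2; lra.
Qed.

Lemma run_automorphism n m : automorphism (run phi n m).
Proof.
elim: m => [|m IH]; first exact: automorphism_id.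
exact: automorphism_comp (stages_automorphism _) IH.
Qed.

Lemma run_in n m x : F x (run phi n m x).
Proof.
elim: m => [|m IH]; first exact: (F_refl equivF).
exact: (F_trans equivF) IH (stages_in _ _).
Qed.

Lemma unrun_automorphism n : automorphism (unrun phi n).
Proof.
elim: n => [|n IH]; first exact: automorphism_id.
exact: automorphism_comp IH (stages_automorphism _).
Qed.

Lemma automorphism_measurable (f : T -> T) :
  automorphism f -> measurable_fun setT f.
Proof. by move=> [g []]. Qed.

Lemma small_pr0 (A : set T) : (forall e, 0 < e -> pr mu A <= e) -> pr mu A = 0.
Proof.
move=> h; apply/eqP; rewrite eq_le pr_ge0 andbT.
by apply/ler_addgt0Pr => e e0; rewrite add0r h.
Qed.

(** The [n]-th base has measure [2 ^ - n], so the points that stay in the bases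
    for ever form a null set. *)
Lemma exists_good_set : exists Z, [/\ null_invariant mu F Z,
  forall n x, ~ Z x -> ~ N n x,
  forall n x, ~ Z x -> exists m, ~ C (n + m)%N (run phi n m x) &
  forall x, ~ Z x -> exists n, ~ C n x].
Proof.
pose E1 n := \bigcap_m (run phi n m @^-1` C (n + m)%N).
pose E2 := \bigcap_n C n.
have mrun n m A : measurable A -> measurable (run phi n m @^-1` A).
  by apply/measurable_preimage/automorphism_measurable/run_automorphism.
have mE1 n : measurable (E1 n) by apply: bigcap_measurable => // m _; exact: mrun.
have mE2 : measurable E2 by exact: bigcap_measurable.
have mE : measurable (\bigcup_n E1 n) by exact: bigcup_measurable.
have half_le1 n : 2^-1 ^+ n <= 1 :> R by apply: exprn_ile1; lra.
have half_ge0 n : 0 <= 2^-1 ^+ n :> R by apply: exprn_ge0; lra.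
have E10 n : pr mu (E1 n) = 0.
  apply: small_pr0 => e /half_pow_lt[m me].
  apply: (le_trans (le_pr mu (mE1 n) (mrun n m _ (mC (n + m))) _)).
    by move=> x /(_ m I).
  rewrite presF //; [|exact: run_automorphism|exact: run_in].
  rewrite pr_base exprD; have := half_le1 n; have := half_ge0 m.
  have := half_ge0 n; nra.
have E20 : pr mu E2 = 0.
  apply: small_pr0 => e /half_pow_lt[m me].
  rewrite (le_trans _ (ltW me)) // -pr_base; apply: le_pr => // x; exact.
have E0 : pr mu (\bigcup_n E1 n) = 0 by exact: pr_bigcup0.
pose S := saturation kappa.
exists ((\bigcup_n N n) `|` (S (\bigcup_n E1 n) `|` S E2)); split.
- apply: null_invariantU.
    by apply: null_invariant_bigcup => n; have [[]] := nextS n.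
  by apply: null_invariantU; exact: saturation_null.
- by move=> n x nZ Nx; apply: nZ; left; exists n.
- move=> n x nZ; apply: contrapT => no; apply: nZ; right; left.
  apply: sub_saturation => //; exists n => // m _ /=.
  by apply: contrapT => nC; apply: no; exists m.
- move=> x nZ; apply: contrapT => no; apply: nZ; right; right.
  apply: sub_saturation => // n _.
  by apply: contrapT => nC; apply: no; exists n.
Qed.

Lemma stages_odometer (k0 : T -> T) :
  automorphism k0 -> (forall x, F x (k0 x)) ->
  (forall x m, (0 < m)%N -> iter m k0 x <> x) ->
  exists t, [/\ automorphism t, forall x, F x (t x),
    forall x m, (0 < m)%N -> iter m t x <> x &
    forall D, measurable D -> (forall x, D x <-> D (t x)) ->
      pr mu D = 0 \/ pr mu (~` D) = 0].
Proof.
move=> [k0' [k0K k0K' mk0 mk0']] k0F k0per.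
have [Z [[mZ Z0 iZ] ZN Zrun Zout]] := exists_good_set.
have C0T : C 0%N = setT := base0.
have Cdec n : C n.+1 `<=` C n by have [[]] := nextS n.
have phiK n : involutive (phi n) by have [[]] := nextS n.
have phi_fixed n x : ~ C n x -> phi n x = x.
  by have [_ [_ h _ _]] := nextS n; exact: h.
have Zphi n x : (~` Z) x -> (~` Z) (phi n x).
  move=> nZ Zx; apply: nZ; apply: iZ Zx; apply: (F_sym equivF); exact: stages_in.
have Zswap n x : (~` Z) x -> (C n.+1 x <-> C n (phi n x) /\ ~ C n.+1 (phi n x)).
  by move=> nZ; have [_ [h _ _ _]] := nextS n; apply/h/ZN.
have [od odE] := exists_odometer Cdec phi_fixed.
have [od' od'E] := exists_odometer_inverse Cdec phi_fixed.
have odinv := od_inverse phiK odE Zphi Zrun od'E Zout.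
have odY := od_Y odE Zphi Zrun.
pose t x := if `[< Z x >] then k0 x else od 0%N x.
pose t' x := if `[< Z x >] then k0' x else od' x.
have Zk0 x : Z x -> Z (k0 x) by apply: iZ.
have Zk0' x : Z x -> Z (k0' x).
  by apply: iZ; apply: (F_sym equivF); rewrite -{2}(k0K' x).
have tZ x : Z x -> t x = k0 x by rewrite /t; case: asboolP.
have tY x : ~ Z x -> t x = od 0%N x by rewrite /t; case: asboolP.
have t'Z x : Z x -> t' x = k0' x by rewrite /t'; case: asboolP.
have t'Y x : ~ Z x -> t' x = od' x by rewrite /t'; case: asboolP.
have glue f (D : nat -> set T) g : measurable_fun setT f ->
    (forall n, measurable (D n)) -> (forall n, measurable_fun setT (g n)) ->
    (forall x, ~ Z x -> exists n, D n x) ->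
    forall h : T -> T, (forall x, Z x -> h x = f x) ->
    (forall n x, ~ Z x -> D n x -> h x = g n x) -> measurable_fun setT h.
  move=> mf mD mg cD h hZ hD _ A mA; rewrite setTI.
  have -> : h @^-1` A = (Z `&` f @^-1` A) `|`
      \bigcup_n (~` Z `&` (D n `&` g n @^-1` A)).
    apply/seteqP; split=> x /=.
      move=> Ahx; have [Zx|nZx] := EM (Z x).
        by left; split=> //; rewrite -hZ.
      have [n Dx] := cD x nZx; right; exists n => //; split=> //; split=> //=.
      by rewrite -(hD n).
    move=> [[Zx Afx]|[n _ [nZx [Dx Agx]]]]; first by rewrite hZ.
    by rewrite (hD n).
  apply: measurableU; first by apply: measurableI => //; exact: measurable_preimage.
  apply: bigcup_measurable => n _; apply: measurableI; first exact: measurableC.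
  by apply: measurableI => //; exact: measurable_preimage.
have mrun n m := automorphism_measurable (run_automorphism n m).
have mt : measurable_fun setT t.
  apply: (glue k0 (fun n => ~` (run phi 0 n @^-1` C n)) (run phi 0)) => //.
  - by move=> n; apply: measurableC; exact: measurable_preimage.
  - by move=> x /(Zrun 0%N x)[m nC]; exists m.
  - by move=> n x nZ nC; rewrite tY // (odE 0%N n).
have mt' : measurable_fun setT t'.
  apply: (glue k0' (fun n => ~` C n) (unrun phi)) => //.
  - by move=> n; exact: measurableC.
  - by move=> n; exact/automorphism_measurable/unrun_automorphism.
  - by move=> n x nZ nC; rewrite t'Y // (od'E n).
have iterZ m x : Z x -> iter m t x = iter m k0 x /\ Z (iter m t x).
  move=> Zx; elim: m => //= m [-> Zm]; rewrite tZ //; split=> //.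
  exact: Zk0.
have iterY m x : ~ Z x -> iter m t x = iter m (od 0%N) x /\ ~ Z (iter m t x).
  move=> Zx; elim: m => //= m [-> Zm]; rewrite tY //; split=> //.
  exact: odY.
exists t; split.
- exists t'; split=> // x; have [Zx|nZx] := EM (Z x).
  + by rewrite tZ // t'Z ?k0K //; exact: Zk0.
  + by rewrite tY // t'Y ?(odinv x nZx).2 //; [have [] := odinv x nZx|exact: odY].
  + by rewrite t'Z // tZ ?k0K' //; exact: Zk0'.
  + by have [Y1 _ e] := odinv x nZx; rewrite t'Y // tY.
- move=> x; have [Zx|nZx] := EM (Z x); first by rewrite tZ.
  by rewrite tY //; have [m nC] := Zrun 0%N x nZx; rewrite (odE 0%N m) //; exact: run_in.
- move=> x m m0; have [Zx|nZx] := EM (Z x).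
    by rewrite (iterZ m x Zx).1; exact: k0per.
  rewrite (iterY m x nZx).1.
  exact: (od_aperiodic C0T Cdec phiK phi_fixed odE Zphi Zswap Zrun).
move=> D mD invD.
have invphi n x : ~ Z x -> (D x <-> D (phi n x)).
  apply: (od_invariant Cdec phiK phi_fixed odE Zphi Zswap Zrun) => y nZ.
  by rewrite -tY.
have indep j := stages_independent j mD mZ Z0 invphi.
have D2 : pr mu D <= pr mu D * pr mu D.
  apply/ler_addgt0Pr => e e0; have e2 : 0 < e / 2 by lra.
  have [L dL] := approximation_dnf baseU mu mD e2.
  have := indep (pickle L); rewrite /B pickleK /= => ind.
  have mL := measurable_dnf baseU L.
  have h1 : pr mu D <= pr mu (D `&` dnf U L) + dist mu D (dnf U L).
    apply: pr_cover => //; [exact: measurableI|exact: measurableY|].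
    by move=> x /=; have := EM (dnf U L x); tauto.
  have h2 : pr mu (dnf U L) <= pr mu D + dist mu D (dnf U L).
    by rewrite distC; exact: pr_dist.
  have := pr_ge0 mu D; have : pr mu D <= 1.
    by rewrite -(prT mu); exact: le_pr.
  nra.
have [->|D0] := eqVneq (pr mu D) 0; first by left.
right; rewrite prC //; have Dgt : 0 < pr mu D by rewrite lt_neqAle eq_sym D0 pr_ge0.
have : pr mu D <= 1 by rewrite -(prT mu); exact: le_pr.
by rewrite -{1}[pr mu D]mulr1 ler_pM2l // in D2; lra.
Qed.

End Stages.

(** The automorphism is the odometer of the stages; on an invariant null set,
    where the odometer misbehaves, it is replaced by [k0]. *)
Theorem ergodic_odometer (k0 : T -> T) :
  automorphism k0 -> (forall x, F x (k0 x)) ->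
  (forall x m, (0 < m)%N -> iter m k0 x <> x) ->
  exists t, [/\ automorphism t, forall x, F x (t x),
    forall x m, (0 < m)%N -> iter m t x <> x &
    forall D, measurable D -> (forall x, D x <-> D (t x)) ->
      pr mu D = 0 \/ pr mu (~` D) = 0].
Proof.
have [s [phi [N [base0 sums0 nextS]]]] := exists_stages.
exact: stages_odometer base0 sums0 nextS k0.
Qed.

End ErgodicOdometer.

(** * The free action *)

Section Points.
Local Open Scope ring_scope.
Context d (T : measurableType d) (R : realType) (mu : probability T R).

(** The forward orbit of an aperiodic point is the disjoint union of the point
    and of the image of the forward orbit, which has the same measure. *)
Lemma aperiodic_points_null (k : T -> T) (x : T) :
  (forall y : T, measurable [set y]) ->
  measurable_fun setT k -> injective k ->
  (forall A : set T, measurable A -> pr mu (k @^-1` A) = pr mu A) ->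
  (forall m, (0 < m)%N -> iter m k x <> x) -> pr mu [set x] = 0.
Proof.
move=> mpt mk injk pk per.
pose A i := \bigcup_n [set iter (i + n) k x].
have mA i : measurable (A i) by exact: bigcup_measurable.
have Ak : k @^-1` A 1%N = A 0%N.
  apply/seteqP; split=> y /= [n _].
    by move=> /injk ->; exists n.
  by move=> ->; exists n.
have A0 : A 0%N = [set x] `|` A 1%N.
  apply/seteqP; split=> y.
    by move=> [[|n] _ ->]; [left|right; exists n].
  by move=> [->|[n _ ->]]; [exists 0%N|exists n.+1].
have := pk _ (mA 1%N); rewrite Ak A0 prU //; first by lra.
apply/seteqP; split=> // y [-> [n _ xn]].
by apply: (per n.+1).
Qed.

End Points.

Theorem proposition1p4 (R : realType) (X : ptopologicalType)
    (E : X -> X -> Prop) (mu : probability (borel X) R) :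
  polish R X ->
  countable_borel_equivalence E ->
  invariant_measure mu E ->
  (exists (Delta : groupType) (b : Delta -> X -> X),
    [/\ countable [set: Delta], free_group Delta & ~ abelian_group Delta] /\
    [/\ borel_action b, free_action b,
        subrelation (orbit_rel b [set: Delta]) E &
        ergodic mu (orbit_rel b [set: Delta])]) ->
  forall (Gamma : groupType) (S : set Gamma),
    countable S -> freely_generated_by S -> ~ abelian_group Gamma ->
  forall gamma : Gamma, S gamma ->
  exists a : Gamma -> X -> X,
    [/\ borel_action a, free_action a,
        subrelation (orbit_rel a [set: Gamma]) E &
        ergodic mu (orbit_rel a (cyclic_subgroup gamma))].
Proof.
move=> /polish_standard_base[U baseU] [equivE _ _] invE.
move=> [D [b [[cD freeD nabD] [[[b1 bM] mb] freeb bE ergb]]]].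
move=> G S cS freeS _ gamma Sgamma.
have mb' g : measurable_fun setT (b g : borel X -> borel X) := mb g.
have b_in g x : E x (b g x) by apply: bE; exists g.
have E_sym x y : E x y -> E y x by exact: (@Equivalence_Symmetric _ _ equivE).
have presE (f : borel X -> borel X) : automorphism f -> (forall x, E x (f x)) ->
    forall A, measurable A -> pr mu (f @^-1` A) = pr mu A.
  move=> autf fE A mA; have [f' [fK f'K mf mf']] := autf.
  rewrite /pr (invE f autf fE _ (measurable_preimage mf mA)); congr (fine (mu _)).
  apply/seteqP; split=> x /=; first by move=> [y Ay <-].
  by move=> Ax; exists (f' x); rewrite /= f'K.
have bK g : cancel (b g) (b g^-1%g) by move=> x; rewrite -bM mulVg b1.
have bK' g : cancel (b g^-1%g) (b g) by move=> x; rewrite -bM mulgV b1.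
have b_aut g : automorphism (b g : borel X -> borel X).
  by exists (b g^-1%g); split.
have presb g (A : set (borel X)) : measurable A -> pr mu (b g @^-1` A) = pr mu A by exact: presE.
have ergb' (A : set (borel X)) : measurable A -> (forall g x, A x <-> A (b g x)) ->
    pr mu A = 0%R \/ pr mu (~` A) = 0%R.
  move=> mA invA; have [|e|e] := ergb A mA; last by right; rewrite /pr e.
    by move=> x _ [g _ <-].
  by left; rewrite /pr e.
have [P [P1 Pdisj table]] := pingpong_table freeD nabD.
pose C n g := pingpong (P (side (n.*2, false))) (P (side (n.*2, true))) g.
have [k [Ck ergk]] := @ergodic_selection _ (borel X) R mu D b b1 bM mb' presb
  ergb' cD U baseU C
  (fun n => table (side (n.*2, false)) (side (n.*2, true)) : forall g, exists p r,
    [/\ C n r, C n (p * r)%g & C n (p * g * r)%g]).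
have exu n : exists u, pingpong (P (side (n.*2.+1, false)))
    (P (side (n.*2.+1, true))) u.
  have [p [u [hu _ _]]] := table (side (n.*2.+1, false)) (side (n.*2.+1, true)) 1%g.
  by exists u.
have [u hu] := choice exu.
pose h n := if odd n then u n./2 else k n./2.
have hP n : pingpong (P (side (n, false))) (P (side (n, true))) (h n).
  rewrite /h; have := odd_double_half n; case: ifP => _ en.
    by have := hu n./2; rewrite (_ : n./2.*2.+1 = n) // -[RHS]en.
  by have := Ck n./2; rewrite /C (_ : n./2.*2 = n) // -[RHS]en.
pose I : set nat := [set n | ~~ odd n].
have hk n : h n.*2 = k n by rewrite /h odd_double doubleK.
have Ik n : generated h I (k n) by rewrite -hk; apply: generated_power; rewrite /I /= odd_double.
pose F x y := exists2 g, generated h I g & b g x = y.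
have F_E x y : F x y -> E x y by move=> [g _ <-].
have equivF : Equivalence F.
  split=> [x|x y [g Ig <-]|x y z [g Ig <-] [g' Ig' <-]].
  - by exists 1%g; [exact: generated1|rewrite b1].
  - by exists g^-1%g; [exact: generated_inv|rewrite bK].
  - by exists (g' * g)%g; [exact: generated_mul|rewrite bM].
have [e [eI Ie]] := enumeration (generated1 h I)
  (sub_countable (subset_card_le (@subsetT _ (generated h I))) cD).
have FE x y : F x y <-> exists n, b (e n) x = y.
  split=> [[g /Ie[n <-] <-]|[n <-]]; first by exists n.
  by exists (e n).
have presF (f : borel X -> borel X) : automorphism f -> (forall x, F x (f x)) ->
    forall A, measurable A -> pr mu (f @^-1` A) = pr mu A.
  by move=> autf fF; apply: presE => // x; exact: F_E.
have ergF (A : set (borel X)) : measurable A -> (forall x y, F x y -> A x -> A y) ->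
    pr mu A = 0%R \/ pr mu (~` A) = 0%R.
  move=> mA invA; apply: ergk => // n x; split; first by apply: invA; exists (k n).
  by apply: invA; exists (k n)^-1%g; [exact: generated_inv|rewrite bK].
have iterb g m x : iter m (b g) x = b (g ^+ m)%g x.
  by elim: m => [|m IH] /=; rewrite ?b1 // IH -bM expgS.
have k0per x m : (0 < m)%N -> iter m (b (k 0%N)) x <> x.
  move=> m0; rewrite iterb => /freeb; rewrite -hk => /eqP.
  exact/negP/(generated_expn P1 Pdisj hP).
have points0 (x : borel X) : pr mu [set x] = 0%R.
  apply: (@aperiodic_points_null _ _ _ mu (b (k 0%N))) => //.
  - exact: (measurable_point baseU).
  - exact: can_inj (bK _).
  - by move=> A mA; exact: presb.
  - by move=> m; exact: k0per.
have [t [[t' [tK tK' mt mt']] tF tper tedg]] := ergodic_odometer (kappa := fun n => b (e n) : borel X -> borel X) equivF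
  (fun n => b_aut (e n)) FE presF ergF points0 baseU (b_aut (k 0%N))
  (fun x => ex_intro2 _ _ (k 0%N) (Ik 0%N) erefl) k0per.
have [iota0 iota_injS] := countable_injP S cS.
have iota_inj s s' : S s -> S s' -> iota0 s = iota0 s' -> s = s'.
  by move=> Ss Ss'; apply: iota_injS; rewrite inE.
pose f := free_letter b h t t' gamma iota0.
have fK : forall l x, f (flip l) (f l x) = x by exact: free_letterK.
exists (letter_action f freeS).
have [a1 aM] := letter_action_is_action freeS fK.
have f_in l x : E x (f l x).
  rewrite /f /free_letter; case: ifP => _; last exact: b_in.
  have t_in y : E y (t y) by exact: F_E.
  have t'_in y : E y (t' y) by have := t_in (t' y); rewrite tK' => /E_sym.
  by case: l.2.
have mf l : measurable_fun setT (f l : borel X -> borel X).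
  by rewrite /f /free_letter; case: l => s [] /=; case: (s == gamma).
split.
- split=> // g; rewrite /borel_fun /letter_action.
  elim: (nf freeS g) => [|l w IH]; first exact: measurable_id.
  by apply: (@measurableT_comp _ _ _ _ _ _ (f l : borel X -> borel X)).
- move=> g x gx; have [Sg rg <-] := nfP freeS g.
  by rewrite (reduced_word_free b1 bM freeb P1 Pdisj hP tK' tF tper iota_inj Sg rg gx)
    word_val_nil.
- move=> x _ [g _ <-]; rewrite /letter_action.
  elim: (nf freeS g) => [|l w IH] /=; first exact: (@Equivalence_Reflexive _ _ equivE).
  exact: (@Equivalence_Transitive _ _ equivE) IH (f_in _ _).
move=> A mA invA.
have [|e0|e0] := tedg A mA; last first.
- by right; rewrite (prE mu (measurableC mA)) e0.
- by left; rewrite (prE mu mA) e0.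
move=> x; apply: invA; exists gamma; first by exists 1%N; left; rewrite expg1.
have := letter_action_letter freeS fK 1%g x (Sgamma : S (gamma, false).1).
by rewrite /letter_val /= mulg1 a1 => ->; rewrite /f /free_letter eqxx.
Qed.
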